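(* Let $m\ge3$ be an integer. If the associated form $\mathbf{Q}\in\mathcal{Q}_2^{2(m-2)}$ of a form $Q\in X_2^m$ is not stable, then $Q$ is linearly equivalent to $z_1^m+z_2^m$. In particular, $\mathbf{Q}$ is then linearly equivalent to $z_1^{m-2}z_2^{m-2}$.
   Context: All topological notions refer to the Zariski topology. $\mathcal{Q}_2^m$ is the complex vector space of binary forms (homogeneous polynomials) of degree $m$ on $\mathbb{C}^2$. $X_2^m$ ($m\ge3$) is the set of $Q\in\mathcal{Q}_2^m$ with non-zero discriminant, i.e. such that the partial derivatives $Q_1=\partial Q/\partial z_1$, $Q_2=\partial Q/\partial z_2$ have no common zero in $\mathbb{C}^2\setminus\{0\}$. Associated form: for $Q\in X_2^m$ let $M(Q):=\mathbb{C}[z_1,z_2]/(Q_1,Q_2)$ (the Milnor algebra). It is a local Artinian Gorenstein algebra; with $\mathfrak{m}$ its maximal ideal, $\mathrm{Soc}(M(Q)):=\{x\in\mathfrak{m}:x\mathfrak{m}=0\}$ is one-dimensional, equals $\mathfrak{m}^{2(m-2)}$, and is spanned by the element $e_0$ represented by the Hessian determinant $\mathrm{Hess}(Q)=\det(\partial^2Q/\partial z_i\partial z_j)$. Let $\omega:\mathrm{Soc}(M(Q))\to\mathbb{C}$ be the linear isomorphism with $\omega(e_0)=1$, and let $e_j$ be the element of $M(Q)$ represented by $z_j$. The associated form of $Q$ is $\mathbf{Q}\in\mathcal{Q}_2^{2(m-2)}$, $\mathbf{Q}(z):=\omega\left((z_1e_1+z_2e_2)^{2(m-2)}\right)$ for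 $z=(z_1,z_2)\in\mathbb{C}^2$. $\mathrm{GL}(2,\mathbb{C})$ acts on binary forms by $(C,Q)\mapsto Q_C$, $Q_C(z):=Q(z(C^{-1})^T)$, with $z$ a row vector; two forms are linearly equivalent if they lie in the same $\mathrm{GL}(2,\mathbb{C})$-orbit. A relative invariant of binary forms of degree $d$ is a polynomial $I:\mathcal{Q}_2^d\to\mathbb{C}$ for which there is an integer $\ell\ge0$ with $I(Q)=(\det C)^{\ell}I(Q_C)$ for all $Q,C$. A form $Q_0\in\mathcal{Q}_2^d$ is stable if (i) its isotropy subgroup under the $\mathrm{GL}(2,\mathbb{C})$-action is finite, and (ii) there exists a non-constant relative invariant $I$ on $\mathcal{Q}_2^d$ such that $I(Q_0)\ne0$ and the $\mathrm{GL}(2,\mathbb{C})$-orbit of $Q_0$ is closed in $\{Q\in\mathcal{Q}_2^d:I(Q)\neq0\}$. It is a standard fact that a non-zero binary form of degree $d$ is stable if and only if each of its linear factors has multiplicity less than $d/2$. *)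

(* Defs.v *)
From HB Require Import structures.
From mathcomp Require Import all_boot all_order all_algebra.
From mathcomp Require Import boolp classical_sets functions cardinality reals.
From mathcomp Require Import complex.
From mathcomp Require Import mpoly.

Set Implicit Arguments.
Unset Strict Implicit.
Unset Printing Implicit Defensive.

Import GRing.Theory.
Local Open Scope classical_set_scope.
Local Open Scope quotient_scope.
Local Open Scope ring_scope.

(* The variables z_1, z_2 are 'X_0, 'X_1, and a point z of C^2 is a row
   vector. *)
Section BinaryForms.
Variable R : realType.
Local Notation C := R[i].

Definition forms (d : nat) : set {mpoly C[2]} := [set Q | Q \is d.-homog].

Definition value (Q : {mpoly C[2]}) (z : 'rV[C]_2) : C :=
  Q.@[fun i => z 0 i].

Definition act (A : 'M[C]_2) (Q : {mpoly C[2]}) : {mpoly C[2]} :=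
  Q \mPo [tuple \sum_(j < 2) (invmx A)^T j i *: 'X_j | i < 2].

Lemma value_act A Q z : value (act A Q) z = value Q (z *m (invmx A)^T).
Proof.
rewrite /value /act comp_mpoly_meval; apply: meval_eq => i.
rewrite tnth_mktuple raddf_sum mxE; apply: eq_bigr => j _ /=.
by rewrite mevalZ mevalXU mulrC.
Qed.

Definition orbit (Q : {mpoly C[2]}) : set {mpoly C[2]} :=
  [set Q' | exists2 A, A \in unitmx & Q' = act A Q].

Definition isotropy (Q : {mpoly C[2]}) : set 'M[C]_2 :=
  [set A | A \in unitmx /\ act A Q = Q].

Definition lin_equiv (Q Q' : {mpoly C[2]}) : Prop := orbit Q Q'.

(* A polynomial function on the vector space of binary forms of degree d is a
   polynomial in the d + 1 coefficients of z_1^k z_2^(d-k), 0 <= k <= d. *)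
Definition pvalue (d : nat) (I : {mpoly C[d.+1]}) (Q : {mpoly C[2]}) : C :=
  I.@[fun k : 'I_d.+1 => Q@_[multinom [tuple (k : nat); (d - k)%N]]].

Definition relative_invariant (d : nat) (I : {mpoly C[d.+1]}) : Prop :=
  exists l : nat, forall Q A, forms d Q -> A \in unitmx ->
    pvalue I Q = (\det A) ^+ l * pvalue I (act A Q).

Definition nonconstant (d : nat) (I : {mpoly C[d.+1]}) : Prop :=
  exists Q Q', [/\ forms d Q, forms d Q' & pvalue I Q <> pvalue I Q'].

Definition zariski_closed (d : nat) (Z : set {mpoly C[2]}) : Prop :=
  exists S : set {mpoly C[d.+1]},
    Z = [set Q | forms d Q /\ forall I, S I -> pvalue I Q = 0].

Definition zariski_closed_in (d : nat) (U A : set {mpoly C[2]}) : Prop :=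
  exists2 Z, zariski_closed d Z & A = Z `&` U.

Definition stable (d : nat) (Q0 : {mpoly C[2]}) : Prop :=
  finite_set (isotropy Q0) /\
  exists I : {mpoly C[d.+1]},
    [/\ relative_invariant I, nonconstant I, pvalue I Q0 <> 0 &
        zariski_closed_in d [set Q | forms d Q /\ pvalue I Q <> 0] (orbit Q0)].

Record X2 (m : nat) : Type := MkX2 {
  X2_form :> {mpoly C[2]};
  X2_homog : forms m X2_form;
  X2_disc : forall z : 'rV[C]_2, z != 0 ->
    ~ (value X2_form^`M(0) z = 0 /\ value X2_form^`M(1) z = 0)
}.

Section MilnorAlgebra.
Variables (m : nat) (hm : (3 <= m)%N) (Q : X2 m).

(* The bound on m does not affect the set; it is an argument so that the idealr
   instance, which requires a proper ideal, can be attached to it. *)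
Definition jacobian_ideal (_ : (3 <= m)%N) (p : {mpoly C[2]}) : bool :=
  `[< exists a b, p = a * Q^`M(0) + b * Q^`M(1) >].

Lemma value0_deriv i : value Q^`M(i) 0 = 0.
Proof.
rewrite /value /mderiv rmorph_sum big_seq big1 //= => n.
have /dhomogP dQ := X2_homog Q.
move=> /dQ /= dn; rewrite mevalZ mevalX.
have : (0 < mdeg (n - U_(i)))%N || (n i == 0)%N.
  have [_|ni] := eqVneq (n i) 0%N; first by rewrite orbT.
  have /submK/(congr1 mdeg) : (U_(i) <= n)%MM.
    by apply/mnm_lepP => j; rewrite mnm1E; case: eqP => // <-; rewrite lt0n.
  rewrite mdegD mdeg1 addn1 orbF lt0n => dn1; apply: contraL hm => /eqP d0.
  by rewrite -dn -dn1 d0.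
case/orP => [|/eqP ->]; last by rewrite mul0r mul0r.
rewrite lt0n mdeg_eq0 => /eqP nz.
case: (pickP (fun j => (n - U_(i))%MM j != 0%N)) => [j nj|nall].
  by rewrite (bigD1 j) //= mxE expr0n (negPf nj) mul0r !mulr0.
by case: nz; apply/mnmP => j; rewrite mnm0E; apply/eqP/negbFE/nall.
Qed.

Lemma jacobian_idealr_closed : idealr_closed (jacobian_ideal hm).
Proof.
split.
- by apply/asboolP; exists 0, 0; rewrite !mul0r addr0.
- apply/asboolP => -[a [b /(congr1 (value^~ 0))]].
  rewrite {1}/value meval1 /value mevalD !mevalM -!/(value _ 0).
  by rewrite !value0_deriv !mulr0 addr0 => /eqP; rewrite oner_eq0.
- move=> a _ _ /asboolP[b1 [c1 ->]] /asboolP[b2 [c2 ->]].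
  apply/asboolP; exists (a * b1 + b2), (a * c1 + c2).
  by rewrite mulrDr !mulrDl !mulrA addrACA.
Qed.

HB.instance Definition _ :=
  isIdealr.Build {mpoly C[2]} (jacobian_ideal hm) jacobian_idealr_closed.

Definition jacobian_idealr : idealr {mpoly C[2]} := jacobian_ideal hm.

Definition milnor : Type := {ideal_quot jacobian_idealr}.

HB.instance Definition _ := GRing.ComNzRing.on milnor.

Definition mcls (p : {mpoly C[2]}) : milnor :=
  \pi_{ideal_quot jacobian_idealr} p.

Definition mscale (c : C) (x : milnor) : milnor := mcls c%:MP * x.

Lemma mclsM p q : mcls (p * q) = mcls p * mcls q.
Proof. exact: rmorphM. Qed.

Lemma mclsD p q : mcls (p + q) = mcls p + mcls q.
Proof. exact: rmorphD. Qed.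

Lemma mcls1 : mcls 1 = 1.
Proof. exact: rmorph1. Qed.

Lemma mscaleA a b x : mscale a (mscale b x) = mscale (a * b) x.
Proof. by rewrite /mscale mulrA -mclsM -mpolyCM. Qed.

Lemma mscale1 : left_id 1 mscale.
Proof. by move=> x; rewrite /mscale mpolyC1 mcls1 mul1r. Qed.

Lemma mscaleDr : right_distributive mscale +%R.
Proof. by move=> a x y; rewrite /mscale mulrDr. Qed.

Lemma mscaleDl x : {morph mscale^~ x : a b / a + b}.
Proof. by move=> a b; rewrite /mscale mpolyCD mclsD mulrDl. Qed.

HB.instance Definition _ :=
  GRing.Zmodule_isLmodule.Build C milnor mscaleA mscale1 mscaleDr mscaleDl.

Definition e_ (i : 'I_2) : milnor := mcls 'X_i.

Definition hessian : {mpoly C[2]} :=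
  \det (\matrix_(i < 2, j < 2) Q^`M(i)^`M(j)).

Definition e0 : milnor := mcls hessian.

(* The ideal generated by the classes of z_1 and z_2; by maximal_idealP, it is
   a maximal ideal of milnor. *)
Definition maximal_ideal : set milnor :=
  [set x | exists a b, x = a * e_ 0 + b * e_ 1].

Lemma mpoly_decomp (p : {mpoly C[2]}) :
  exists c a b, p = c%:MP + a * 'X_0 + b * 'X_1.
Proof.
pose D (q : {mpoly C[2]}) := exists c a b, q = c%:MP + a * 'X_0 + b * 'X_1.
rewrite -/(D p) [p]mpolyE; apply: (big_ind D).
- by exists 0, 0, 0; rewrite !mul0r mpolyC0 !addr0.
- move=> _ _ [c [a [b ->]]] [c' [a' [b' ->]]].
  exists (c + c'), (a + a'), (b + b').
  by rewrite mpolyCD !mulrDl [LHS]addrACA [X in X + _ = _]addrACA.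
move=> n _; set c := p@_n.
have DX i : n i != 0%N -> c *: 'X_[n] = (c *: 'X_[n - U_(i)]) * 'X_i.
  move=> ni; rewrite -scalerAl -mpolyXD submK //.
  by apply/mnm_lepP => j; rewrite mnm1E; case: eqP => // <-; rewrite lt0n.
have [/DX -> | /negPn/eqP n0] := boolP (n 0 != 0%N).
  by exists 0, (c *: 'X_[n - U_(0%R)]), 0; rewrite mpolyC0 add0r mul0r addr0.
have [/DX -> | /negPn/eqP n1] := boolP (n 1 != 0%N).
  by exists 0, 0, (c *: 'X_[n - U_(1%R)]); rewrite mpolyC0 mul0r !add0r.
exists c, 0, 0; rewrite !mul0r !addr0 -alg_mpolyC; congr (_ *: _).
rewrite -mpolyX0; congr mpolyX; apply/mnmP => i; rewrite mnm0E.
case: i => [[|[|]]] // Hi; [apply: etrans n0 | apply: etrans n1];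
  by congr (fun_of_multinom n _); apply/val_inj.
Qed.

Lemma maximal_idealP : ~ maximal_ideal 1 /\
  forall x, ~ maximal_ideal x -> exists y, maximal_ideal (1 - x * y).
Proof.
split=> [[a [b]]|x].
  rewrite -[a]reprK -[b]reprK -mcls1 -!mclsM -mclsD => /eqP.
  rewrite -[_ == _]Quotient.idealrBE => /asboolP[u [v]].
  move=> /(congr1 (value^~ 0)); rewrite /value mevalB mevalD !mevalM meval1.
  rewrite mevalD !mevalM !mevalXU -!/(value _ 0) !value0_deriv !mxE.
  by rewrite !mulr0 !addr0 subr0 => /eqP; rewrite oner_eq0.
rewrite -[x]reprK -/(mcls _); have [c [a [b ->]]] := mpoly_decomp (repr x).
rewrite 2!mclsD !mclsM; have [-> []|c0 _] := eqVneq c 0.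
  by exists (mcls a), (mcls b); rewrite mpolyC0 /mcls raddf0 add0r.
exists (mcls c^-1%:MP), (- mcls a * mcls c^-1%:MP), (- mcls b * mcls c^-1%:MP).
rewrite !mulrDl -mclsM -mpolyCM divff // mcls1 /e_.
rewrite -addrA opprD addrA subrr add0r opprD !mulNr.
by congr (- _ - _); rewrite mulrAC.
Qed.

Definition socle : set milnor :=
  [set x | maximal_ideal x /\ forall y, maximal_ideal y -> x * y = 0].

Definition is_omega (omega : milnor -> C) : Prop :=
  [/\ forall (c : C) x y, socle x -> socle y ->
        omega (c *: x + y) = c * omega x + omega y,
      set_bij socle [set: C] omega &
      omega e0 = 1].

(* omega is only relevant on the socle, where it is determined by is_omega. *)
Definition is_associated_form (BQ : {mpoly C[2]}) : Prop :=
  forms (2 * (m - 2)) BQ /\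
  exists2 omega, is_omega omega &
    forall z : 'rV[C]_2,
      value BQ z = omega ((z 0 0 *: e_ 0 + z 0 1 *: e_ 1) ^+ (2 * (m - 2))).

End MilnorAlgebra.

End BinaryForms.

(* Main.v *)
From HB Require Import structures.
From mathcomp Require Import all_boot all_order all_fingroup all_algebra.
From mathcomp Require Import boolp classical_sets functions cardinality reals.
From mathcomp Require Import complex mpoly.
From mathcomp Require Import zify ring.
Require Import Defs.

(* Write d = 2 n for the degree of the associated form, n = m - 2.

   A form all of whose roots have multiplicity less than n is stable. Put
   f = prod_k l_k with linear forms l_k. For a listing of the indices, let the
   bracket monomial of a configuration (w_k) of d vectors be the product of the
   2 x 2 determinants of consecutive pairs. Bracket monomials are multilinear
   in the w_k, and any symmetric function of the w_k that is homogeneous of one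
   and the same degree in each of them is a polynomial in the coefficients of
   prod_k w_k. Hence the power sums of the bracket monomials are relative
   invariants, one of which does not vanish at f, and that the bracket
   monomials of w be proportional to those of l after some reordering is a
   closed condition on prod_k w_k. Because all multiplicities are less than n, enough
   brackets can be completed to non-vanishing bracket monomials for this
   proportionality to force w_k to be proportional to l_k B for one invertible
   matrix B, so that condition defines the orbit of f where the invariant is
   not zero.

   So if the associated form is not stable, it has a root v of multiplicity at
   least n. Expanding omega((s u + v)^(2 n)) in s shows that omega kills
   u^j v^(2 n - j) for j < n, so by Gorenstein duality in the Milnor algebra
   the (n+1)-st power of the linear form v is zero, that is, a linear
   combination of Q_1 and Q_2. Thus a directional derivative of Q is the
   (m-1)-st power of a linear form; integrating it puts Q in the form
   x^m + y^m, and then the associated form is a multiple of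
   x^(m-2) y^(m-2) by the binomial formula. *)

Set Implicit Arguments.
Unset Strict Implicit.
Unset Printing Implicit Defensive.
Import GRing.Theory Num.Theory.
Local Open Scope ring_scope.

(** * Pairings of a multiset *)

Section Pairing.
Variables (T E : eqType) (f : T -> E).

Fixpoint distinct_pairs (s : seq T) : bool :=
  if s is p :: q :: s' then (f p != f q) && distinct_pairs s' else true.

Lemma seq_argmax (F : T -> nat) (s : seq T) : (0 < size s)%N ->
  exists2 x, x \in s & forall y, y \in s -> (F y <= F x)%N.
Proof.
elim: s => // a [_ _|b s /(_ isT) [x xs xmax] _].
  by exists a => [|y]; rewrite ?mem_head // mem_seq1 => /eqP ->.
have [le_ax|/ltnW le_xa] := leqP (F a) (F x).
  by exists x => [|y]; rewrite inE ?xs ?orbT // => /predU1P[->|/xmax].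
exists a => [|y]; rewrite inE ?eqxx // => /predU1P[->//|/xmax le_yx].
exact: leq_trans le_xa.
Qed.

Lemma count3_leq (x y z : E) (s : seq T) : x != y -> x != z -> y != z ->
  (count (fun t => f t == x) s + count (fun t => f t == y) s +
     count (fun t => f t == z) s <= size s)%N.
Proof.
move=> xy xz yz; elim: s => //= t s IHs.
have [ftx|_] := eqVneq (f t) x; first by rewrite ftx (negPf xy) (negPf xz); lia.
have [fty|_] := eqVneq (f t) y; first by rewrite fty (negPf yz); lia.
by case: (f t == z); lia.
Qed.

(* Pairing an element of a largest class with an element of a second largest
   one meets every class of the extremal size. *)
Lemma pairing (k : nat) (s : seq T) : size s = (2 * k)%N ->
    (forall e, (count (fun t => f t == e) s <= k)%N) ->
  exists2 s', perm_eq s' s & distinct_pairs s'.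
Proof.
elim: k s => [|k IHk] s sz_s le_s.
  by move/eqP: sz_s; rewrite muln0 size_eq0 => /eqP ->; exists [::].
pose F t := count (fun t' => f t' == f t) s.
have [|x xs xmax] := @seq_argmax F s; first by rewrite sz_s mulnS.
have sz2 : (0 < size [seq t <- s | f t != f x])%N.
  rewrite size_filter; have := le_s (f x).
  suff: (F x + count (fun t => f t != f x) s = size s)%N by rewrite sz_s /F; lia.
  exact: count_predC.
have [y] := seq_argmax F sz2; rewrite mem_filter => /andP[fyx ys] ymax.
have yxs : y \in rem x s.
  by rewrite (perm_mem (perm_to_rem xs)) inE in ys; case: eqP ys fyx => // ->;
    rewrite eqxx.
have [||s' ps' ds'] := IHk (rem y (rem x s)).
- by rewrite !size_rem // sz_s mulnS.
- move=> e; rewrite !count_rem xs yxs /=.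
  have [_|fxe] := eqVneq (f x) e; first by have := le_s e; lia.
  have [_|fye] := eqVneq (f y) e; first by have := le_s e; lia.
  (* A third class with more than [k] elements would, by maximality, make both chosen classes at
     least as large: [3 * k.+1] elements among [2 * k.+1]. *)
  rewrite !subn0 leqNgt; apply/negP => lt_k.
  have /hasP[t ts /eqP te] : has (fun t => f t == e) s.
    by rewrite has_count; apply: leq_trans lt_k.
  have := xmax t ts; have := ymax t; rewrite mem_filter te eq_sym fxe ts => /(_ isT).
  rewrite /F te; have := count3_leq s fyx fye fxe; rewrite sz_s; lia.
exists (x :: y :: s'); last by rewrite /= eq_sym fyx.
rewrite (perm_trans _ (_ : perm_eq (x :: rem x s) s)) ?(perm_sym _ s) ?perm_to_rem //.
rewrite perm_cons (perm_trans _ (_ : perm_eq (y :: rem y (rem x s)) _)) //.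
  by rewrite perm_cons.
by rewrite perm_sym perm_to_rem.
Qed.

End Pairing.

Section PairingExtension.
Variables (T : finType) (E : eqType) (f : T -> E) (n : nat).
Hypothesis cardT : #|T| = (2 * n)%N.
Hypothesis small_classes : forall e, (#|[pred k | f k == e]| < n)%N.

Lemma count_classE e : count (fun k => f k == e) (enum T) = #|[pred k | f k == e]|.
Proof. by rewrite cardE size_filter -enumT; apply: eq_count. Qed.

(** Classes have at most [n - 1] elements, so removing any two indices leaves a list within the
    bound of [pairing]. The pair itself may lie in one class: any bracket can be completed to a
    monomial whose other factors do not vanish. *)
Lemma pairing_cons2 (a b : T) : a != b ->
  exists2 s, perm_eq [:: a, b & s] (enum T) & distinct_pairs f s.
Proof.
move=> ab; have ba : b \in rem a (enum T).
  by rewrite mem_rem_uniq ?enum_uniq // inE eq_sym ab mem_enum.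
have pab : perm_eq (enum T) [:: a, b & rem b (rem a (enum T))].
  rewrite (perm_trans (perm_to_rem (mem_enum T a))) // perm_cons.
  exact: perm_to_rem.
have szT : size (enum T) = (2 * n)%N by rewrite -cardE.
have [||s ps ds] := @pairing _ _ f n.-1 (rem b (rem a (enum T))).
- by have := perm_size pab; rewrite szT /=; lia.
- move=> e; have := small_classes e; rewrite -count_classE (seq.permP pab) /=; lia.
by exists s => //; rewrite perm_sym (perm_trans pab) // !perm_cons perm_sym.
Qed.

(** Four classes lose an element and so fit the bound [n - 2]. Another class could violate it only
    with [n - 1] elements; then the class of [x], being largest, has [n - 1] too, and both together
    overfill the [2 * n - 4] remaining indices. *)
Lemma pairing_cons4 (x y z t : T) :
    (forall k, #|[pred i | f i == f k]| <= #|[pred i | f i == f x]|)%N ->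
    uniq [:: f x; f y; f z; f t] ->
  exists2 s, perm_eq [:: x, y, z, t & s] (enum T) & distinct_pairs f s.
Proof.
move=> xmax uf; have us : uniq [:: x; y; z; t] by apply: (@map_uniq _ _ f).
have [r pr] : exists r, perm_eq (enum T) ([:: x; y; z; t] ++ r).
  exists [seq k <- enum T | k \notin [:: x; y; z; t]].
  rewrite -(perm_filterC (mem [:: x; y; z; t])) perm_cat2r uniq_perm //.
    by rewrite filter_uniq ?enum_uniq.
  by move=> k; rewrite mem_filter mem_enum andbT.
have szT : size (enum T) = (2 * n)%N by rewrite -cardE.
have szr := perm_size pr; rewrite szT /= in szr.
have cE e := seq.permP pr (fun k => f k == e).
have [||s ps ds] := @pairing _ _ f n.-2 r.
- by case: n szr => [|[|k]] /=; lia.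
- move=> e; have := small_classes e; have := small_classes (f x).
  have := cE e; have := cE (f x); rewrite !count_classE /=.
  rewrite !eqxx; have [_|fxe] := eqVneq (f x) e; first by lia.
  have [_|_] := eqVneq (f y) e; first by lia.
  have [_|_] := eqVneq (f z) e; first by lia.
  have [_|_] := eqVneq (f t) e; first by lia.
  move: uf; rewrite /= !inE !negb_or => /andP[/and3P[xy xz xt] _].
  rewrite !(eq_sym _ (f x)) (negPf xy) (negPf xz) (negPf xt) !add0n => cx ce lt_x lt_e.
  have cr : (count (fun k => f k == f x) r + count (fun k => f k == e) r <= size r)%N.
    rewrite -(count_predUI) (_ : count (predI _ _) _ = 0%N) ?addn0 ?count_size //.
    by apply/eqP; rewrite -leqn0 leqNgt -has_count -all_predC; apply/allP => k _ /=;
       case: eqP => // ->.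
  have [e0|] := posnP #|[pred k | f k == e]|; first by lia.
  by case/card_gt0P=> k /eqP fk; have := xmax k; rewrite fk; lia.
exists s => //; rewrite perm_sym (perm_trans pr) //.
by rewrite !perm_cons perm_sym.
Qed.

End PairingExtension.

(** * Brackets of plane vectors *)

Lemma ord2P (i : 'I_2) : i = 0 \/ i = 1.
Proof. by case: i => -[|[|//]] lt_i; [left|right]; apply: val_inj. Qed.

Section Brackets.
Variable K : fieldType.
Implicit Types (u v w : 'rV[K]_2) (B : 'M[K]_2).

Definition bracket u v := u 0 0 * v 0 1 - u 0 1 * v 0 0.

Lemma row2P u v : u 0 0 = v 0 0 -> u 0 1 = v 0 1 -> u = v.
Proof.
by move=> e0 e1; apply/rowP => i; case: (ord2P i) => ->.
Qed.

Lemma mulmx2E u B i : (u *m B) 0 i = u 0 0 * B 0 i + u 0 1 * B 1 i.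
Proof.
rewrite mxE big_ord_recl big_ord1; congr (_ + u _ _ * B _ _); exact: val_inj.
Qed.

Lemma det2E B : \det B = B 0 0 * B 1 1 - B 0 1 * B 1 0.
Proof.
rewrite (expand_det_row _ 0) big_ord_recl big_ord1 /cofactor !det_mx11 !mxE /=.
rewrite expr0 expr1 mul1r mulN1r mulrN.
by congr (B _ _ * B _ _ - B _ _ * B _ _); apply: val_inj.
Qed.

Lemma bracketC u v : bracket v u = - bracket u v.
Proof. by rewrite /bracket; ring. Qed.

Lemma bracketvv (u : 'rV[K]_2) : bracket u u = 0.
Proof. by rewrite /bracket; ring. Qed.

Lemma mulmx2_neq0 (u : 'rV[K]_2) (B : 'M_2) :
  B \in unitmx -> u != 0 -> u *m B != 0.
Proof. by move=> uB; apply: contraNneq => uB0; rewrite -(mulmxK uB u) uB0 mul0mx. Qed.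

Lemma bracketM u v B : bracket (u *m B) (v *m B) = \det B * bracket u v.
Proof. by rewrite /bracket !mulmx2E det2E; ring. Qed.

Lemma bracketZl a u v : bracket (a *: u) v = a * bracket u v.
Proof. by rewrite /bracket !mxE; ring. Qed.

Lemma bracket0P u v : v != 0 -> bracket u v = 0 -> exists a, u = a *: v.
Proof.
move=> v0 /eqP; rewrite subr_eq0 => /eqP uv.
have [v00|v00] := eqVneq (v 0 0) 0; last first.
  exists (u 0 0 / v 0 0); apply: row2P; rewrite mxE ?divfK //.
  by rewrite mulrAC uv mulfK.
have v01 : v 0 1 != 0.
  by apply: contraNneq v0 => v01; apply/eqP/row2P; rewrite mxE.
exists (u 0 1 / v 0 1); apply: row2P; rewrite mxE ?divfK //.
by rewrite v00 mulr0; apply: (mulIf v01); rewrite uv v00 mulr0 mul0r.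
Qed.

Lemma bracket0_trans u v w : w != 0 -> bracket u w = 0 -> bracket v w = 0 ->
  bracket u v = 0.
Proof.
move=> w0 /(bracket0P w0)[a ->] /(bracket0P w0)[b ->].
by rewrite /bracket !mxE; ring.
Qed.

(* The point of the projective line defined by u; None is the point at
   infinity, and also the junk value at u = 0. *)
Definition proj_point u : option K :=
  if u 0 1 == 0 then None else Some (u 0 0 / u 0 1).

Lemma bracket_eq0 u v : u != 0 -> v != 0 ->
  (bracket u v == 0) = (proj_point u == proj_point v).
Proof.
have nz (x : 'rV[K]_2) : x != 0 -> x 0 1 = 0 -> x 0 0 != 0.
  by move=> x0 x1; apply: contraNneq x0 => x00; apply/eqP/row2P; rewrite mxE.
move=> /nz u0 /nz v0; rewrite /proj_point /bracket.
have [u1|u1] := eqVneq (u 0 1) 0; have [v1|v1] := eqVneq (v 0 1) 0.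
- by rewrite u1 v1 mulr0 mul0r subr0 !eqxx.
- by rewrite u1 mul0r subr0 mulf_eq0 (negPf v1) (negPf (u0 u1)).
- by rewrite v1 mulr0 sub0r oppr_eq0 mulf_eq0 (negPf u1) (negPf (v0 v1)).
rewrite subr_eq0 (inj_eq Some_inj) eqr_div // [v 0 0 * _]mulrC.
by [].
Qed.

Section Prod.
Variable T : eqType.
Implicit Types (l : T -> 'rV[K]_2) (s : seq T).

Fixpoint bracket_prod l s : K :=
  if s is p :: q :: s' then bracket (l p) (l q) * bracket_prod l s' else 1.

Lemma bracket_prod_neq0 l s : (forall k, l k != 0) ->
  (bracket_prod l s != 0) = distinct_pairs (proj_point \o l) s.
Proof.
move=> l0; have [k] := ubnP (size s); elim: k s => // k IHk [|p [|q s]] /=.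
- by rewrite oner_eq0.
- by rewrite oner_eq0.
by move=> /ltnW lt_k; rewrite mulf_eq0 negb_or IHk ?bracket_eq0.
Qed.

Lemma bracket_prodM l B s k : size s = (2 * k)%N ->
  bracket_prod (fun t => l t *m B) s = \det B ^+ k * bracket_prod l s.
Proof.
elim: k s => [|k IHk] s; first by case: s => // _; rewrite mulr1.
rewrite mulnS; case: s => [|p [|q s]] //= [/IHk ->].
by rewrite bracketM exprS; ring.
Qed.

End Prod.

Lemma bracket_prod_map (T T' : eqType) (g : T' -> T) (l : T -> 'rV[K]_2) (s : seq T') :
  bracket_prod l (map g s) = bracket_prod (l \o g) s.
Proof.
have [k] := ubnP (size s); elim: k s => // k IHk [|p [|q s]] //= lt_k.
by rewrite IHk // ltnW.
Qed.

End Brackets.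

(** * Configurations determined by their bracket monomials *)

Section Rigidity.
Variables (K : fieldType) (T : finType) (n : nat) (l : T -> 'rV[K]_2).
Hypothesis cardT : #|T| = (2 * n)%N.
Hypothesis l_neq0 : forall k, l k != 0.
Hypothesis small_classes :
  forall e, (#|[pred k | proj_point (l k) == e]| < n)%N.

(** Any two classes together have fewer than [2 * n] members, so a third direction exists. Taking
    [x] in a largest class prepares for [pairing_cons4]. *)
Lemma three_classes : exists x y z,
  [/\ forall k, (#|[pred i | proj_point (l i) == proj_point (l k)]| <=
                  #|[pred i | proj_point (l i) == proj_point (l x)]|)%N,
      bracket (l x) (l y) != 0, bracket (l x) (l z) != 0 &
      bracket (l y) (l z) != 0].
Proof.
have n_gt0 : (0 < n)%N := leq_ltn_trans (leq0n _) (small_classes None).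
have szT : size (enum T) = (2 * n)%N by rewrite -cardE.
have [|x _ xmax] := seq_argmax
    (fun k => #|[pred i | proj_point (l i) == proj_point (l k)]|) (s := enum T).
  by rewrite szT muln_gt0.
have pick2 e e' : exists y, (proj_point (l y) != e) && (proj_point (l y) != e').
  apply/existsP; apply: contraT; rewrite negb_exists => /forallP /= noy.
  suff : (#|T| <= #|[pred k | proj_point (l k) == e]| +
                  #|[pred k | proj_point (l k) == e']|)%N.
    by have := small_classes e; have := small_classes e'; rewrite cardT; lia.
  rewrite -cardUI (leq_trans _ (leq_addr _ _)) // subset_leq_card //.
  by apply/fintype.subsetP=> k _; have := noy k; rewrite !inE -negb_or negbK.
have [y /andP[yx _]] := pick2 (proj_point (l x)) None.
have [z /andP[zx zy]] := pick2 (proj_point (l x)) (proj_point (l y)).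
exists x, y, z; split; rewrite ?bracket_eq0 // 1?eq_sym //.
by move=> k; apply: xmax; rewrite mem_enum.
Qed.

Variables (w : T -> 'rV[K]_2) (c : K).
Hypothesis c_neq0 : c != 0.
Hypothesis brackets_eq : forall s, perm_eq s (enum T) ->
  bracket_prod w s = c * bracket_prod l s.

(** Complete the pair to a bracket monomial that does not vanish at [l]; the same monomial at [w] is
    then non-zero and has the bracket of [w a] and [w b] as a factor. *)
Lemma rigid_neq0 a b : bracket (l a) (l b) != 0 -> bracket (w a) (w b) != 0.
Proof.
move=> ab; have neq_ab : a != b by apply: contraNneq ab => ->; rewrite bracketvv.
have [s ps ds] := pairing_cons2 cardT small_classes neq_ab.
have : bracket_prod w [:: a, b & s] != 0.
  by rewrite brackets_eq // mulf_neq0 //= mulf_neq0 // bracket_prod_neq0.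
by rewrite /= mulf_eq0 negb_or => /andP[].
Qed.

Lemma rigid_vec_neq0 a : w a != 0.
Proof.
have [x [y [z [_ xy xz yz]]]] := three_classes.
have [ax|ax] := eqVneq (bracket (l a) (l x)) 0; last first.
  by apply: contraNneq (rigid_neq0 ax) => ->; rewrite /bracket !mxE !mul0r subr0.
have : bracket (l a) (l y) != 0.
  have [mu la] := bracket0P (l_neq0 x) ax.
  rewrite la bracketZl mulf_neq0 //; apply: contraNneq (l_neq0 a) => mu0.
  by rewrite la mu0 scale0r.
move=> /rigid_neq0; apply: contraNneq => ->.
by rewrite /bracket !mxE !mul0r subr0.
Qed.

(** A monomial that starts with this pair vanishes at [l], hence at [w], while by [rigid_neq0] its
    other factors do not vanish at [w]. *)
Lemma rigid_eq0 a b : bracket (l a) (l b) = 0 -> bracket (w a) (w b) = 0.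
Proof.
move=> ab; have [->|neq_ab] := eqVneq a b; first exact: bracketvv.
have [s ps ds] := pairing_cons2 cardT small_classes neq_ab.
have /eqP := brackets_eq ps; rewrite /= ab mul0r mulr0 mulf_eq0 => /orP[/eqP//|].
suff : bracket_prod w s != 0 by move=> /negPf->.
have [k] := ubnP (size s); elim: k s ds {ps} => [//|k IHk] [|p [|q s]] /=;
  rewrite ?oner_eq0 //.
case/andP=> pq ds /ltnW lt_k; rewrite mulf_neq0 ?IHk // rigid_neq0 //.
by rewrite bracket_eq0.
Qed.

(** Equality of cross-ratios: two bracket monomials that differ only in how these four vectors are
    paired are proportional with the same constant [c], and their common factors cancel. If [l t] is
    parallel to one of the other three, the identity is checked directly. *)
Lemma rigid_cross_ratio x y z t :
    (forall k, (#|[pred i | proj_point (l i) == proj_point (l k)]| <=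
                  #|[pred i | proj_point (l i) == proj_point (l x)]|)%N) ->
    bracket (l x) (l y) != 0 -> bracket (l x) (l z) != 0 ->
    bracket (l y) (l z) != 0 ->
  bracket (w x) (w y) * bracket (w z) (w t) *
    (bracket (l x) (l z) * bracket (l y) (l t)) =
  bracket (w x) (w z) * bracket (w y) (w t) *
    (bracket (l x) (l y) * bracket (l z) (l t)).
Proof.
move=> xmax xy xz yz.
have [yt|yt] := eqVneq (bracket (l y) (l t)) 0.
  by rewrite yt (rigid_eq0 yt) !(mulr0, mul0r).
have [zt|zt] := eqVneq (bracket (l z) (l t)) 0.
  by rewrite zt (rigid_eq0 zt) !(mulr0, mul0r).
have [tx|tx] := eqVneq (bracket (l t) (l x)) 0.
  have [mu wt] := bracket0P (rigid_vec_neq0 x) (rigid_eq0 tx).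
  have [nu lt] := bracket0P (l_neq0 x) tx.
  by rewrite wt lt /bracket !mxE; ring.
have [|s ps ds] := pairing_cons4 cardT small_classes xmax (y := y) (z := z) (t := t).
  move: xy xz yz yt zt tx; rewrite !bracket_eq0 // /= !inE !negb_or.
  by rewrite (eq_sym (proj_point (l t))) => -> -> -> -> -> ->.
have ps' : perm_eq [:: x, z, y, t & s] (enum T).
  rewrite -(permPr ps) perm_cons -![_ :: _ :: t :: s]/([:: _; _] ++ t :: s).
  by rewrite perm_cat2r (perm_catC [:: z] [:: y]).
have := brackets_eq ps; have := brackets_eq ps'; rewrite /= => e' e.
have w0 : bracket_prod w s != 0.
  have : bracket_prod w [:: x, y, z, t & s] != 0.
    by rewrite brackets_eq // mulf_neq0 //= !mulf_neq0 // bracket_prod_neq0.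
  by rewrite /= !mulf_eq0 !negb_or => /and3P[].
have l0 : bracket_prod l s != 0 by rewrite bracket_prod_neq0.
apply: (mulIf w0); apply: (mulIf l0); apply: (mulIf c_neq0).
transitivity ((bracket (w x) (w y) * (bracket (w z) (w t) * bracket_prod w s)) *
  (c * (bracket (l x) (l z) * (bracket (l y) (l t) * bracket_prod l s))));
    first by ring.
by rewrite e -e'; ring.
Qed.

(** Sending three directions of [l] to those of [w] fixes the matrix up to a scalar; the cross-ratio
    identity then settles all other directions. *)
Lemma bracket_prod_rigid : exists (B : 'M[K]_2) (r : T -> K),
  B \in unitmx /\ forall k, r k != 0 /\ w k = r k *: (l k *m B).
Proof.
have [x [y [z [xmax xy xz yz]]]] := three_classes.
(* These weights make [l y *m B] and [l z *m B] multiples of [w y] and [w z], and [l x *m B] a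
   multiple of the combination of [w y] and [w z] that is parallel to [w x] by Cramer's rule. *)
pose a := bracket (w x) (w z) * bracket (l x) (l y).
pose b := bracket (w x) (w y) * bracket (l x) (l z).
pose B : 'M[K]_2 := \matrix_(i, j)
  ((if i == 0 then l z 0 1 else - l z 0 0) * a * w y 0 j -
   (if i == 0 then l y 0 1 else - l y 0 0) * b * w z 0 j).
have BE v : v *m B = (bracket v (l z) * a) *: w y - (bracket v (l y) * b) *: w z.
  by apply: row2P; rewrite mulmx2E !mxE /= /bracket; ring.
have uB : B \in unitmx.
  rewrite unitmxE unitfE; apply: contraTneq (rigid_neq0 yz) => detB.
  have := bracketM (l y) (l z) B; rewrite detB mul0r !BE !bracketvv !mul0r.
  rewrite !scale0r sub0r subr0 => /eqP.
  have -> : bracket ((bracket (l y) (l z) * a) *: w y)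
      (- ((bracket (l z) (l y) * b) *: w z)) =
      bracket (l y) (l z) ^+ 2 * a * b * bracket (w y) (w z).
    by rewrite (bracketC (l y)) /bracket !mxE; ring.
  rewrite negbK expr2 /a /b !mulf_eq0 (negPf xy) (negPf xz) (negPf yz).
  by rewrite (negPf (rigid_neq0 xz)) (negPf (rigid_neq0 xy)).
have par t : bracket (w t) (l t *m B) = 0.
  rewrite BE; have /eqP := rigid_cross_ratio t xmax xy xz yz.
  rewrite -subr_eq0 -oppr_eq0 => /eqP <-.
  by rewrite /a /b /bracket !mxE; ring.
have ex t : exists r, w t = r *: (l t *m B).
  exact: bracket0P (mulmx2_neq0 uB (l_neq0 t)) (par t).
have [r wr] := fin_all_exists ex.
exists B, r; split=> // k; split=> //.
by apply: contraNneq (rigid_vec_neq0 k) => r0; rewrite wr r0 scale0r.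
Qed.

End Rigidity.

(** * Binary forms *)

Lemma horner_inj (K : numDomainType) (p q : {poly K}) :
  (forall x, p.[x] = q.[x]) -> p = q.
Proof.
move=> epq; apply/eqP; rewrite -subr_eq0; apply/negP => /negP/max_poly_roots.
move=> /(_ [seq i%:R | i <- iota 0 (size (p - q))]); rewrite size_map size_iota ltnn.
rewrite map_inj_uniq ?iota_uniq; last by move=> i j /eqP; rewrite eqr_nat => /eqP.
move=> H; suff: false by []; apply: H => //.
by apply/allP => x _; rewrite rootE hornerD hornerN epq subrr.
Qed.

Section LinearForms.
Variable K : fieldType.

Definition linform (u : 'rV[K]_2) : {mpoly K[2]} := u 0 0 *: 'X_0 + u 0 1 *: 'X_1.

Lemma linform_comp (u : 'rV[K]_2) (B : 'M[K]_2) :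
  linform u \mPo [tuple \sum_(j < 2) B^T j i *: 'X_j | i < 2] = linform (u *m B).
Proof.
rewrite /linform comp_mpolyD !comp_mpolyZ /comp_mpoly !mmapX !mmap1U !tnth_mktuple.
have ord2 (F : 'I_2 -> {mpoly K[2]}) : \sum_j F j = F 0 + F 1.
  by rewrite big_ord_recl big_ord1; congr (_ + F _); apply: val_inj.
rewrite !ord2 !mulmx2E !mxE !scalerDr !scalerDl !scalerA addrACA.
by congr (_ + _ + (_ + _)).
Qed.

Lemma linformZ c (u : 'rV[K]_2) : linform (c *: u) = c *: linform u.
Proof. by rewrite /linform !mxE scalerDr !scalerA. Qed.

Lemma linform_neq0 (u : 'rV[K]_2) : u != 0 -> linform u != 0.
Proof.
apply: contraNneq => u0; apply/eqP/row2P; rewrite mxE.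
  have /(congr1 (mcoeff U_(0))) := u0.
  by rewrite mcoeffD !mcoeffZ !mcoeffXU mcoeff0 mulr1 mulr0 addr0.
have /(congr1 (mcoeff U_(1))) := u0.
by rewrite mcoeffD !mcoeffZ !mcoeffXU mcoeff0 mulr1 mulr0 add0r.
Qed.

End LinearForms.

(** * Restriction of a form to a line *)

Section OnLine.
Variable K : comNzRingType.
Implicit Types (f g : {mpoly K[2]}) (a b : 'rV[K]_2).

(* The one-variable polynomial s |-> f (s a + b). *)
Definition on_line a b f : {poly K} :=
  mmap (@polyC K) (fun i => a 0 i *: 'X + (b 0 i)%:P) f.

HB.instance Definition _ a b := GRing.RMorphism.copy (on_line a b)
  (mmap (@polyC K) (fun i => a 0 i *: 'X + (b 0 i)%:P)).

Lemma on_lineD a b f g : on_line a b (f + g) = on_line a b f + on_line a b g.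
Proof. exact: rmorphD. Qed.

Lemma on_lineM a b f g : on_line a b (f * g) = on_line a b f * on_line a b g.
Proof. exact: rmorphM. Qed.

Lemma on_lineC a b c : on_line a b c%:MP = c%:P.
Proof. exact: mmapC. Qed.

Lemma on_lineZ a b c f : on_line a b (c *: f) = c *: on_line a b f.
Proof. by rewrite /on_line mmapZ mul_polyC. Qed.

Lemma on_lineX a b i : on_line a b 'X_i = a 0 i *: 'X + (b 0 i)%:P.
Proof. by rewrite /on_line mmapX mmap1U. Qed.

Lemma horner_on_line a b f s :
  (on_line a b f).[s] = f.@[fun i => (s *: a + b) 0 i].
Proof.
rewrite /on_line /meval /mmap -horner_evalE rmorph_sum /=.
apply: eq_bigr => m _; rewrite rmorphM /mmap1 rmorph_prod /= !horner_evalE hornerC.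
congr (_ * _); apply: eq_bigr => i _.
by rewrite rmorphXn /= horner_evalE hornerD hornerZ hornerX hornerC !mxE mulrC.
Qed.

Lemma mderivXU (i j : 'I_2) : ('X_i : {mpoly K[2]})^`M(j) = ((i == j)%:R)%:MP.
Proof.
rewrite mderivX mnm1E; case: eqP => [->|_]; last by rewrite scale0r mpolyC0.
rewrite scale1r (_ : (_ - _)%MM = 0%MM) ?mpolyX0 //.
by apply/mnmP => k; rewrite mnmBE subnn mnm0E.
Qed.

(** Chain rule: the identity is stable under sums and products, so constants and variables
    suffice. *)
Lemma deriv_on_line a b f :
  (on_line a b f)^`() = a 0 0 *: on_line a b f^`M(0) + a 0 1 *: on_line a b f^`M(1).
Proof.
pose D f := (on_line a b f)^`() =
  a 0 0 *: on_line a b f^`M(0) + a 0 1 *: on_line a b f^`M(1).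
have DD f1 f2 : D f1 -> D f2 -> D (f1 + f2).
  by rewrite /D => D1 D2;
    rewrite on_lineD derivD D1 D2 !mderivD !on_lineD !scalerDr addrACA.
have DM f1 f2 : D f1 -> D f2 -> D (f1 * f2).
  rewrite /D => D1 D2; rewrite on_lineM derivM D1 D2 !mderivM !on_lineD !on_lineM.
  by rewrite mulrDl mulrDr -!scalerAl -!scalerAr !scalerDr addrACA.
have DC c : D c%:MP.
  by rewrite /D !mderivC !rmorph0 !scaler0 addr0 on_lineC derivC.
have D1 : D 1 by apply: (DC 1).
have DX i : D 'X_i.
  rewrite /D on_lineX derivD derivZ derivX derivC addr0 !mderivXU !on_lineC.
  have [->|->] := ord2P i; first by rewrite /= scaler0 addr0.
  by rewrite /= scaler0 add0r.
have DXn i k : D ('X_i ^+ k).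
  elim: k => [|k IHk]; first exact: D1.
  by rewrite exprS; apply: DM.
rewrite -/(D f) [f]mpolyE; apply: (big_ind D) => //; first by apply: (DC 0).
move=> m _; rewrite -mul_mpolyC; apply: (DM) => //; rewrite mpolyXE_id.
by apply: (big_ind D) => [|f1 f2|i _]; [exact: D1 | exact: DM | exact: DXn].
Qed.

Lemma horner_deriv_on_line a b f s :
  (on_line a b f)^`().[s] = a 0 0 * f^`M(0).@[fun i => (s *: a + b) 0 i] +
                            a 0 1 * f^`M(1).@[fun i => (s *: a + b) 0 i].
Proof. by rewrite deriv_on_line hornerD !hornerZ !horner_on_line. Qed.

End OnLine.

(** * Duality between linear forms and points *)

Section DualCoordinates.
Variable K : fieldType.
Implicit Types (u v z : 'rV[K]_2).

Definition dot u z : K := u 0 0 * z 0 0 + u 0 1 * z 0 1.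

(** A quarter turn: for non-zero [v] it gives a generator of the zero line of [linform v], and it
    converts [dot] into [bracket]. *)
Definition perp v : 'rV[K]_2 := \row_j (if j == 0 then v 0 1 else - v 0 0).

Lemma dot_perp v z : dot (perp v) z = bracket z v.
Proof. by rewrite /dot /bracket !mxE /=; ring. Qed.

Lemma bracket_perp u v : bracket (perp u) (perp v) = bracket u v.
Proof. by rewrite /bracket !mxE /=; ring. Qed.

Lemma bracket_perpr v z : bracket z (perp v) = - dot v z.
Proof. by rewrite /dot /bracket !mxE /=; ring. Qed.

Lemma linformD u v : linform (u + v) = linform u + linform v.
Proof. by rewrite /linform !mxE !scalerDl addrACA. Qed.

Lemma on_line_linform a b u : on_line a b (linform u) = dot u a *: 'X + (dot u b)%:P.
Proof.
rewrite /linform on_lineD !on_lineZ !on_lineX /dot !scalerDr !scalerA.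
by rewrite addrACA -scalerDl -!mul_polyC -!polyCM -polyCD.
Qed.

Lemma row2_coords u v z : bracket u v != 0 ->
  z = (bracket z v / bracket u v) *: u + (bracket u z / bracket u v) *: v.
Proof.
by move=> uv; apply: row2P; rewrite !mxE /bracket in uv *; field.
Qed.

(** [linform (perp v)] and [- linform (perp u)], divided by [bracket u v], form the basis of linear
    forms dual to [u], [v]. *)
Lemma linform_coords u v z : bracket u v != 0 -> linform z =
  (dot z u / bracket u v) *: linform (perp v) -
  (dot z v / bracket u v) *: linform (perp u).
Proof.
move=> uv; have lD x y : linform (x - y) = linform x - linform y :> {mpoly K[2]}.
  by rewrite /linform !mxE !scalerBl opprD addrACA.
rewrite -!linformZ -lD; congr linform.
by apply: row2P; rewrite !mxE /= /dot /bracket in uv *; field.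
Qed.

Lemma exists_dot_neq0 v : v != 0 -> exists w, dot v w != 0.
Proof.
move=> v0; have [v00|v00] := eqVneq (v 0 0) 0.
  exists (delta_mx 0 1); rewrite /dot !mxE /= mulr0 add0r mulr1.
  by apply: contraNneq v0 => v01; apply/eqP/row2P; rewrite mxE.
by exists (delta_mx 0 0); rewrite /dot !mxE /= mulr0 addr0 mulr1.
Qed.

End DualCoordinates.

(** * Dehomogenization and factorization of binary forms *)

Section Forms.
Variable R : realType.
Local Notation C := R[i].
Implicit Types (f g : {mpoly C[2]}) (u v z a b : 'rV[C]_2).

Definition xpow (i j : nat) : {mpoly C[2]} := 'X_0 ^+ i * 'X_1 ^+ j.

Definition mon2 (i j : nat) : 'X_{1..2} := [multinom [tuple i; j]].

Lemma xpowE i j : xpow i j = 'X_[mon2 i j].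
Proof.
rewrite mpolyXE_id big_ord_recl big_ord1 !multinomE !(tnth_nth 0%N) /=.
by congr (_ * 'X__ ^+ _); apply: val_inj.
Qed.

Lemma mnm2P (m m' : 'X_{1..2}) : m 0 = m' 0 -> m 1 = m' 1 -> m = m'.
Proof.
by move=> e0 e1; apply/mnmP => i; case: (ord2P i) => ->.
Qed.

Lemma mdeg2 (m : 'X_{1..2}) : mdeg m = (m 0%R + m 1%R)%N.
Proof. by rewrite mdegE big_ord_recl big_ord1; congr (_ + m _)%N; apply: val_inj. Qed.

Lemma mon20 i j : mon2 i j 0 = i. Proof. by rewrite multinomE (tnth_nth 0%N). Qed.
Lemma mon21 i j : mon2 i j 1 = j. Proof. by rewrite multinomE (tnth_nth 0%N). Qed.

Lemma form_eq d f g : forms d f -> forms d g ->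
  (forall k, (k <= d)%N -> f@_(mon2 k (d - k)) = g@_(mon2 k (d - k))) -> f = g.
Proof.
move=> hf hg efg; apply/mpolyP => m.
have [md|md] := eqVneq (mdeg m) d; last first.
  by rewrite (dhomog_nemf_coeff hf md) (dhomog_nemf_coeff hg md).
rewrite (_ : m = mon2 (m 0) (d - m 0)); last first.
  by apply: mnm2P; rewrite ?mon20 ?mon21 // -md mdeg2 addKn.
by apply: efg; rewrite -md mdeg2 leq_addr.
Qed.

Lemma forms_add d f g : forms d f -> forms d g -> forms d (f + g).
Proof. exact: dhomogD. Qed.

Lemma forms_scale d c f : forms d f -> forms d (c *: f).
Proof. exact: dhomogZ. Qed.

Lemma forms_mul d e f g : forms d f -> forms e g -> forms (d + e) (f * g).
Proof. exact: dhomogM. Qed.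

Lemma forms_sum d (I : Type) (r : seq I) (P : pred I) (F : I -> {mpoly C[2]}) :
  (forall i, P i -> forms d (F i)) -> forms d (\sum_(i <- r | P i) F i).
Proof. exact: rpred_sum. Qed.

Lemma forms_xpow i j : forms (i + j) (xpow i j).
Proof. by rewrite xpowE /forms /= dhomogX /= mdeg2 mon20 mon21. Qed.

Lemma value_on_line a b f s : (on_line a b f).[s] = value f (s *: a + b).
Proof. exact: horner_on_line. Qed.

(** Setting [z_2 = 1] is multiplicative, and injective on the forms of a given degree, which reduces
    binary forms to polynomials in one variable. *)
Definition dehom f : {poly C} := on_line (delta_mx 0 0) (delta_mx 0 1) f.

HB.instance Definition _ := GRing.RMorphism.copy dehom
  (on_line (delta_mx 0 0) (delta_mx 0 1)).

Lemma dehomD f g : dehom (f + g) = dehom f + dehom g.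
Proof. exact: on_lineD. Qed.

Lemma dehomM f g : dehom (f * g) = dehom f * dehom g.
Proof. exact: on_lineM. Qed.

Lemma dehomZ c f : dehom (c *: f) = c *: dehom f.
Proof. exact: on_lineZ. Qed.

Lemma dehom0 : dehom 0 = 0.
Proof. exact: rmorph0. Qed.

Lemma dehomX0 : dehom 'X_0 = 'X.
Proof. by rewrite /dehom on_lineX !mxE /= scale1r addr0. Qed.

Lemma dehomX1 : dehom 'X_1 = 1.
Proof. by rewrite /dehom on_lineX !mxE /= scale0r add0r. Qed.

Lemma dehom_xpow i j : dehom (xpow i j) = 'X^i.
Proof. by rewrite /xpow rmorphM !rmorphXn /= dehomX0 dehomX1 expr1n mulr1. Qed.

(** Inverse of [dehom] on polynomials of degree at most [d]; higher coefficients are dropped. *)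
Definition hom_form (d : nat) (p : {poly C}) : {mpoly C[2]} :=
  \sum_(k < d.+1) p`_k *: xpow k (d - k).

Lemma forms_hom d p : forms d (hom_form d p).
Proof.
apply: forms_sum => k _; apply: forms_scale.
by rewrite -{1}(subnKC (leq_ord k)); apply: forms_xpow.
Qed.

Lemma mcoeff_hom d p k : (k <= d)%N -> (hom_form d p)@_(mon2 k (d - k)) = p`_k.
Proof.
move=> le_kd; rewrite raddf_sum /= (bigD1 (Ordinal (le_kd : k < d.+1)%N)) //=.
rewrite mcoeffZ xpowE mcoeffX eqxx mulr1 big1 ?addr0 // => i neq_ik.
rewrite mcoeffZ xpowE mcoeffX; case: eqP => [/(congr1 (fun m : 'X_{1..2} => m 0))|].
  by rewrite !mon20 => eik; case/eqP: neq_ik; apply: val_inj.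
by rewrite mulr0.
Qed.

Lemma formE d f : forms d f ->
  f = \sum_(k < d.+1) f@_(mon2 k (d - k)) *: xpow k (d - k).
Proof.
move=> hf; pose p := \poly_(k < d.+1) f@_(mon2 k (d - k)).
have -> : \sum_(k < d.+1) f@_(mon2 k (d - k)) *: xpow k (d - k) = hom_form d p.
  by apply: eq_bigr => k _; rewrite coef_poly ltn_ord.
apply: (form_eq hf (forms_hom d p)) => k le_kd.
by rewrite mcoeff_hom // coef_poly ltnS le_kd.
Qed.

Lemma dehomE d f : forms d f -> dehom f = \poly_(k < d.+1) f@_(mon2 k (d - k)).
Proof.
move=> /formE hf; rewrite {1}hf rmorph_sum poly_def /=.
by apply: eq_bigr => k _; rewrite dehomZ dehom_xpow.
Qed.

Lemma size_dehom d f : forms d f -> (size (dehom f) <= d.+1)%N.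
Proof. by move=> /dehomE ->; apply: size_poly. Qed.

Lemma dehom_hom d (p : {poly C}) : (size p <= d.+1)%N -> dehom (hom_form d p) = p.
Proof.
move=> sz_p; rewrite (dehomE (forms_hom d p)); apply/polyP => k.
rewrite coef_poly; case: ltnP => [lt_kd|le_dk]; first by rewrite mcoeff_hom.
by rewrite nth_default // (leq_trans sz_p).
Qed.

Lemma dehom_inj d f g : forms d f -> forms d g -> dehom f = dehom g -> f = g.
Proof.
move=> hf hg; rewrite (dehomE hf) (dehomE hg) => /polyP efg.
by apply: (form_eq hf hg) => k le_kd; have := efg k; rewrite !coef_poly ltnS le_kd.
Qed.

Lemma form_value_inj d f g : forms d f -> forms d g -> value f =1 value g -> f = g.
Proof.
move=> hf hg efg; apply: (dehom_inj hf hg); apply: horner_inj => x.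
by rewrite !value_on_line efg.
Qed.

Definition prodform (T : finType) (w : T -> 'rV[C]_2) : {mpoly C[2]} :=
  \prod_k linform (w k).

Lemma forms_linform u : forms 1 (linform u).
Proof. by apply: dhomogD; apply: dhomogZ; rewrite dhomogX /= mdeg1. Qed.

Lemma forms_prodform (T : finType) (w : T -> 'rV[C]_2) : forms #|T| (prodform w).
Proof.
rewrite cardE /prodform -big_enum /=; elim: (enum T) => [|k s IHs].
  by rewrite big_nil; apply: dhomog1.
by rewrite big_cons -[size _]/(1 + size s)%N; apply: forms_mul => //;
  apply: forms_linform.
Qed.

Lemma value_linform u z : value (linform u) z = u 0 0 * z 0 0 + u 0 1 * z 0 1.
Proof. by rewrite /value mevalD !mevalZ !mevalXU. Qed.

Lemma value_prodform (T : finType) (w : T -> 'rV[C]_2) z :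
  value (prodform w) z = \prod_k (w k 0 0 * z 0 0 + w k 0 1 * z 0 1).
Proof.
by rewrite /value rmorph_prod; apply: eq_bigr => k _; apply: value_linform.
Qed.

(** The dehomogenized form splits over the algebraically closed field; factors [z_2], the roots at
    infinity, make up for the drop of its degree below [d]. *)
Lemma form_factor d f : forms d f -> exists (c : C) (w : 'I_d -> 'rV[C]_2),
  (forall k, w k != 0) /\ f = c *: prodform w.
Proof.
move=> hf; have [rs fE] := closed_field_poly_normal (dehom f).
pose w (k : 'I_d) : 'rV[C]_2 :=
  if (k < size rs)%N then \row_j (if j == 0 then 1 else - rs`_k) else \row_j (j != 0)%:R.
exists (lead_coef (dehom f)), w; split.
  move=> k; apply/eqP => /rowP wk; have := wk 0; have := wk 1.
  rewrite /w; case: ifP; rewrite !mxE /= => _; last by move=> /eqP; rewrite oner_eq0.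
  by move=> _ /eqP; rewrite oner_eq0.
have [f0|f0] := eqVneq (lead_coef (dehom f)) 0.
  rewrite f0 scale0r; apply: (dehom_inj hf (dhomog0 _ _ _ )).
  by rewrite rmorph0; apply/eqP; rewrite -lead_coef_eq0 f0.
have le_rs : (size rs <= d)%N.
  by have := size_dehom hf; rewrite fE size_scale // size_prod_XsubC ltnS.
apply: (dehom_inj hf); first by apply: forms_scale;
  rewrite -[X in forms X]card_ord; apply: forms_prodform.
rewrite dehomZ {1}fE; congr (_ *: _).
rewrite rmorph_prod /=.
transitivity (\prod_(k < d) if (k < size rs)%N then 'X - (rs`_k)%:P else 1).
  rewrite -big_mkcond /= (big_nth 0) big_mkord.
  by rewrite (big_ord_widen _ (fun k => 'X - (rs`_k)%:P) le_rs).
apply: eq_bigr => k _; rewrite rmorphD /= !dehomZ dehomX0 dehomX1 /w.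
by case: ifP; rewrite !mxE /= ?scale1r ?scale0r ?add0r // alg_polyC polyCN.
Qed.

End Forms.

(** * Symmetric multihomogeneous functions of the linear factors *)

Lemma sum_perm_finfun (A : comNzRingType) (T : finType) (F : {ffun T -> T} -> A) :
  \sum_(s : {perm T}) F (pval s) = \sum_(f : {ffun T -> T} | injectiveb f) F f.
Proof.
rewrite [RHS](reindex (@pval T)) /=; first by apply: eq_bigl => s; rewrite (valP s).
by exists (insubd (1%g : {perm T})) => f Uf; [apply: val_inj|]; apply: insubdK.
Qed.

(** Inclusion-exclusion on the image: expand the products on the right over all maps [f]; the signed
    sum over the sets [S] that contain the image of [f] is one if [f] is onto, hence injective, and
    zero otherwise. *)
Lemma permanent_Ryser (A : comNzRingType) (T : finType) (M : T -> T -> A) :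
  \sum_(s : {perm T}) \prod_k M (s k) k =
  \sum_(S : {set T}) (-1) ^+ #|~: S| * \prod_k \sum_(j in S) M j k.
Proof.
under [RHS]eq_bigr => S _ do
  rewrite (bigA_distr_big (mem S) (fun k j => M j k)) /= big_mkcond mulr_sumr.
rewrite exchange_big /=.
transitivity (\sum_(f : {ffun T -> T} | injectiveb f) \prod_k M (f k) k).
  by rewrite -sum_perm_finfun; apply: eq_bigr => s _; apply: eq_bigr => k _;
    rewrite -pvalE.
rewrite big_mkcond; apply: eq_bigr => f _.
pose im := [set f k | k in T].
transitivity ((\prod_j (1 + - (j \notin im)%:R)) * \prod_k M (f k) k : A).
  have [f_inj|f_ninj] := boolP (injectiveb f).
    rewrite -[LHS]mul1r; congr (_ * _); symmetry; apply: big1 => j _.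
    suff -> : j \in im by rewrite subr0.
    have /injectiveP/injF_bij[g _ gK] := f_inj.
    by rewrite -(gK j) imset_f.
  suff [j jim] : exists j, j \notin im by rewrite (bigD1 j) //= jim subrr !mul0r.
  apply/existsP; rewrite -negb_forall; apply: contra f_ninj => /forallP im_all.
  have /imset_injP f_inj : #|im| == #|T| by apply/eqP/eq_card => j; rewrite im_all.
  by apply/injectiveP => x y; apply: f_inj.
rewrite bigA_distr mulr_suml; apply: eq_bigr => S _.
rewrite (bigID (mem S)) /= big1 ?mul1r => [|j ->] //.
rewrite (eq_big (mem (~: S)) (fun j => - (j \notin im)%:R)); first last.
- by move=> j /negPf ->.
- by move=> j; rewrite !inE.
rewrite prodrN -mulrA; congr (_ * _).
have [fS|fS] := boolP (f \in ffun_on (mem S)).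
  rewrite big1 ?mul1r // => j; rewrite inE => jS.
  suff -> : j \notin im by [].
  by apply: contra jS => /imsetP[k _ ->]; apply: (ffun_onP fS).
have [k fkS] : exists k, f k \notin S.
  by apply/existsP; rewrite -negb_forall; apply: contra fS => /forallP fS;
    apply/ffun_onP.
by rewrite (bigD1 (f k)) ?inE //= imset_f // !mul0r.
Qed.

Section FormFunctions.
Variable R : realType.
Local Notation C := R[i].
Variable d : nat.
Implicit Types (phi psi : {mpoly C[2]} -> C) (z : 'rV[C]_2).

Definition form_fun phi :=
  exists I : {mpoly C[d.+1]}, forall f, forms d f -> pvalue I f = phi f.

Lemma form_fun_const c : form_fun (fun=> c).
Proof. by exists c%:MP => f _; rewrite /pvalue mevalC. Qed.

Lemma form_funD phi psi : form_fun phi -> form_fun psi ->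
  form_fun (fun f => phi f + psi f).
Proof.
by move=> [I hI] [J hJ]; exists (I + J) => f hf; rewrite -hI // -hJ // /pvalue mevalD.
Qed.

Lemma form_funM phi psi : form_fun phi -> form_fun psi ->
  form_fun (fun f => phi f * psi f).
Proof.
by move=> [I hI] [J hJ]; exists (I * J) => f hf; rewrite -hI // -hJ // /pvalue mevalM.
Qed.

Lemma form_fun_sum (I : finType) (P : pred I) (phi : I -> {mpoly C[2]} -> C) :
  (forall i, form_fun (phi i)) -> form_fun (fun f => \sum_(i | P i) phi i f).
Proof.
move=> hphi; have [J hJ] := choice hphi.
by exists (\sum_(i | P i) J i) => f hf; rewrite /pvalue raddf_sum;
  apply: eq_bigr => i _; apply: hJ.
Qed.

Lemma form_fun_prod (I : finType) (phi : I -> {mpoly C[2]} -> C) :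
  (forall i, form_fun (phi i)) -> form_fun (fun f => \prod_i phi i f).
Proof.
move=> hphi; have [J hJ] := choice hphi.
by exists (\prod_i J i) => f hf; rewrite /pvalue rmorph_prod;
  apply: eq_bigr => i _; apply: hJ.
Qed.

Lemma form_fun_value z : form_fun (fun f => value f z).
Proof.
exists (\sum_(k < d.+1) (z 0 0 ^+ k * z 0 1 ^+ (d - k)) *: 'X_k) => f hf.
rewrite {2}(formE hf) /pvalue /value !raddf_sum; apply: eq_bigr => k _ /=.
by rewrite !mevalZ mevalXU /xpow mevalM !rmorphXn /= !mevalXU mulrC.
Qed.

End FormFunctions.

Section Multihomogeneous.
Variables (R : realType) (T : finType).
Local Notation C := R[i].
Local Notation config := (T -> 'rV[C]_2).
Implicit Types (e : T -> nat) (F G : config -> C) (w : config).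

(** Polynomial functions homogeneous of degree [e k] in the [k]-th vector. Generating them from
    monomials by sums turns [symmetrization] into an induction. *)
Inductive multihomog : (T -> nat) -> (config -> C) -> Prop :=
| multihomog_monomial (c : C) (a b : T -> nat) :
    multihomog (fun k => a k + b k)%N
      (fun w => c * \prod_k (w k 0 0 ^+ a k * w k 0 1 ^+ b k))
| multihomogD e F G : multihomog e F -> multihomog e G ->
    multihomog e (fun w => F w + G w).

Lemma multihomogM e e' F G : multihomog e F -> multihomog e' G ->
  multihomog (fun k => e k + e' k)%N (fun w => F w * G w).
Proof.
move=> hF hG; elim: hF => {e F} [c a b|e F F' _ hF _ hF']; last first.
  rewrite (_ : (fun w => _) = fun w => F w * G w + F' w * G w).
    exact: multihomogD.
  by apply: funext => w; rewrite mulrDl.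
elim: hG => {e' G} [c' a' b'|e' G G' _ hG _ hG']; last first.
  rewrite (_ : (fun w => _) = fun w =>
    c * (\prod_k (w k 0 0 ^+ a k * w k 0 1 ^+ b k)) * G w +
    c * (\prod_k (w k 0 0 ^+ a k * w k 0 1 ^+ b k)) * G' w).
    exact: multihomogD.
  by apply: funext => w; rewrite mulrDr.
rewrite (_ : (fun k => _) = fun k => ((a k + a' k) + (b k + b' k))%N); last first.
  by apply: funext => k; rewrite addnACA.
rewrite (_ : (fun w => _) = fun w => c * c' *
    \prod_k (w k 0 0 ^+ (a k + a' k)%N * w k 0 1 ^+ (b k + b' k)%N)).
  exact: multihomog_monomial.
apply: funext => w; rewrite mulrACA -big_split /=; congr (_ * _).
by apply: eq_bigr => k _; rewrite !exprD mulrACA.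
Qed.

Lemma multihomogZ c e F : multihomog e F -> multihomog e (fun w => c * F w).
Proof.
elim=> {e F} [c' a b|e F G _ hF _ hG].
  rewrite (_ : (fun w => _) = fun w => (c * c') *
    \prod_k (w k 0 0 ^+ a k * w k 0 1 ^+ b k)); first exact: multihomog_monomial.
  by apply: funext => w; rewrite mulrA.
rewrite (_ : (fun w => _) = fun w => c * F w + c * G w); first exact: multihomogD.
by apply: funext => w; rewrite mulrDr.
Qed.

Lemma multihomog1 : multihomog (fun=> 0%N) (fun=> 1).
Proof.
have := multihomog_monomial 1 (fun=> 0%N) (fun=> 0%N).
rewrite (_ : (fun w => _) = fun=> 1) //.
by apply: funext => w; rewrite mul1r big1 // => k _; rewrite mulr1.
Qed.

Lemma multihomog_sum (I : finType) e (F : I -> config -> C) :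
  (forall i, multihomog e (F i)) -> multihomog e (fun w => \sum_i F i w).
Proof.
move=> hF; have z : multihomog e (fun=> 0).
  have := multihomogZ 0 (multihomog_monomial 0 e (fun=> 0%N)).
  rewrite (_ : (fun k => _) = e); last by apply: funext => k; rewrite addn0.
  by rewrite (_ : (fun w => _) = fun=> 0) //; apply: funext => w; rewrite mul0r.
suff : forall r : seq I, multihomog e (fun w => \sum_(i <- r) F i w) by apply.
elim=> [|i r IHr].
  by rewrite (_ : (fun w => _) = fun=> 0) //; apply: funext => w; rewrite big_nil.
rewrite (_ : (fun w => _) = fun w => F i w + \sum_(j <- r) F j w).
  exact: multihomogD.
by apply: funext => w; rewrite big_cons.
Qed.

Lemma multihomog_prod (I : finType) e (F : I -> config -> C) :
    (forall i, multihomog e (F i)) ->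
  multihomog (fun k => #|I| * e k)%N (fun w => \prod_i F i w).
Proof.
move=> hF.
suff : forall r : seq I,
    multihomog (fun k => size r * e k)%N (fun w => \prod_(i <- r) F i w).
  move/(_ (enum I)); rewrite -cardE (_ : (fun w => _) = fun w => \prod_i F i w) //.
  by apply: funext => w; rewrite big_enum.
elim=> [|i r IHr].
  rewrite (_ : (fun w => _) = fun=> 1); first exact: multihomog1.
  by apply: funext => w; rewrite big_nil.
rewrite (_ : (fun w => _) = fun w => F i w * \prod_(j <- r) F j w).
  exact: multihomogM.
by apply: funext => w; rewrite big_cons.
Qed.

Lemma multihomogX e F n : multihomog e F ->
  multihomog (fun k => n * e k)%N (fun w => F w ^+ n).
Proof.
move=> hF; have := @multihomog_prod 'I_n e (fun=> F) (fun=> hF).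
rewrite card_ord (_ : (fun w => _) = fun w => F w ^+ n) //.
by apply: funext => w; rewrite prodr_const card_ord.
Qed.

Lemma multihomog_bracket p q :
  multihomog (fun k => (k == p) + (k == q))%N (fun w => bracket (w p) (w q)).
Proof.
have pick i (x : T -> C) : \prod_k x k ^+ (k == i) = x i.
  rewrite (bigD1 i) //= eqxx expr1 big1 ?mulr1 // => k /negPf ->.
  by rewrite expr0.
have mon i j w : \prod_k (w k 0 0 ^+ (k == i) * w k 0 1 ^+ (k == j)) =
    w i 0 0 * w j 0 1 :> C.
  by rewrite big_split /= (pick i (fun k => w k 0 0)) (pick j (fun k => w k 0 1)).
rewrite (_ : (fun w => bracket _ _) = fun w =>
  1 * (\prod_k (w k 0 0 ^+ (k == p) * w k 0 1 ^+ (k == q))) +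
  (-1) * (\prod_k (w k 0 0 ^+ (k == q) * w k 0 1 ^+ (k == p)))).
  apply: multihomogD; first exact: multihomog_monomial.
  rewrite (_ : (fun k => _) = fun k => ((k == q) + (k == p))%N).
    exact: multihomog_monomial.
  by apply: funext => k; rewrite addnC.
by apply: funext => w; rewrite !mon /bracket; ring.
Qed.

(** [bracket_prod] drops an unpaired last entry, so it is for even length that every occurrence of
    [k] counts as one degree. *)
Lemma multihomog_bracket_prod (s : seq T) : ~~ odd (size s) ->
  multihomog (fun k => count_mem k s) (fun w => bracket_prod w s).
Proof.
have [n] := ubnP (size s); elim: n s => // n IHn [|p [|q s]] //=.
  by move=> _ _; apply: multihomog1.
move=> /ltnW lt_n; rewrite negbK => /(IHn _ lt_n) hs.
rewrite (_ : (fun k => _) = fun k => ((k == p) + (k == q) + count_mem k s)%N).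
  exact: multihomogM (multihomog_bracket p q) hs.
by apply: funext => k; rewrite addnA !(eq_sym k).
Qed.

(* A symmetric function of degree e in each vector is a combination of
   products prod_k g(w_k) with g a form of degree e (polarization); writing g
   as a product of linear forms h_i, such a product is prod_i f(h_i), where
   f is the form with linear factors w_k. *)
Lemma symmetrization (d : nat) (e : nat) F : #|T| = d -> multihomog (fun=> e) F ->
  exists I : {mpoly C[d.+1]}, forall w,
    pvalue I (prodform w) = \sum_(s : {perm T}) F (fun k => w (s k)).
Proof.
move=> cardT; suff sym e' : multihomog e' F -> (forall k, e' k = e) ->
    exists2 phi, form_fun d phi &
      forall w, phi (prodform w) = \sum_(s : {perm T}) F (fun k => w (s k)).
  move=> /sym[] // phi [I hI] hphi; exists I => w.
  by rewrite hI // -cardT; apply: forms_prodform.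
elim=> {e' F} [c a b|e' F G _ hF _ hG] he; last first.
  have [phi hphi phiE] := hF he; have [psi hpsi psiE] := hG he.
  exists (fun f => phi f + psi f); first exact: form_funD.
  by move=> w; rewrite phiE psiE big_split.
(* Ryser's formula for a monomial produces, for each [S], the product over [k] of the values of this
   form at [w k]. *)
pose g (S : {set T}) : {mpoly C[2]} := \sum_(k in S) xpow R (a k) (b k).
have hg S : forms e (g S).
  by apply: forms_sum => k _; rewrite -(he k); apply: forms_xpow.
have /choice[h hh] S : exists x : C * ('I_e -> 'rV[C]_2), g S = x.1 *: prodform x.2.
  by have [x [h [_ gE]]] := form_factor (hg S); exists (x, h).
exists (fun f => \sum_(S : {set T}) (c * (-1) ^+ #|~: S|) *
  ((h S).1 ^+ #|T| * \prod_i value f ((h S).2 i))).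
  apply: form_fun_sum => S; apply: form_funM; first exact: form_fun_const.
  apply: form_funM; first exact: form_fun_const.
  by apply: form_fun_prod => i; apply: form_fun_value.
move=> w; rewrite -mulr_sumr.
transitivity (c * \sum_(s : {perm T}) \prod_k value (xpow R (a (s k)) (b (s k))) (w k)).
  rewrite (permanent_Ryser (fun i k =>
    value (xpow R (a i) (b i)) (w k))) mulr_sumr; apply: eq_bigr => S _.
  rewrite -mulrA; congr (_ * (_ * _)).
  transitivity (\prod_k value (g S) (w k)); last first.
    by apply: eq_bigr => k _; rewrite /value raddf_sum.
  rewrite hh; under eq_bigr => i _ do rewrite value_prodform.
  rewrite exchange_big /= -prodr_const -big_split /=; apply: eq_bigr => k _.
  rewrite /value mevalZ -/(value _ _) value_prodform; congr (_ * _).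
  by apply: eq_bigr => i _; rewrite mulrC [X in _ + X]mulrC.
congr (_ * _); rewrite (reindex_inj invg_inj) /=; apply: eq_bigr => s _.
rewrite (reindex_inj (@perm_inj _ s)) /=; apply: eq_bigr => k _.
by rewrite permK /value /xpow mevalM !rmorphXn /= !mevalXU.
Qed.

End Multihomogeneous.

(** * Stability *)

(** If all positive power sums vanished, the values of [p * 'X] at the [x i] would sum to zero for
    every [p]. A [p] that vanishes at all values except [x i0] yields instead a positive multiple of
    a non-zero number. *)
Lemma power_sum_neq0 (K : numFieldType) (I : finType) (x : I -> K) (i0 : I) :
  x i0 != 0 -> exists2 e, (0 < e)%N & \sum_i x i ^+ e != 0.
Proof.
move=> x0; apply: contrapT => no_e.
have sum0 (p : {poly K}) : \sum_i (p * 'X).[x i] = 0.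
  under eq_bigr => i _ do rewrite horner_coef.
  rewrite exchange_big /= big1 // => k _; rewrite -mulr_sumr coefMX.
  case: (val k) => [|j] /=; first by rewrite mul0r.
  have [-> | sj] := eqVneq (\sum_i x i ^+ j.+1) 0; first by rewrite mulr0.
  by case: no_e; exists j.+1.
have := sum0 (\prod_(i | x i != x i0) ('X - (x i)%:P)).
rewrite (bigID (fun i => x i == x i0)) /= [X in _ + X]big1 ?addr0; last first.
  by move=> i xi; rewrite hornerM (bigD1 i) //= !hornerM hornerXsubC subrr !mul0r.
rewrite (eq_bigr (fun=> ((\prod_(i | x i != x i0) ('X - (x i)%:P)) * 'X).[x i0])).
  rewrite sumr_const => /eqP;
    rewrite mulrn_eq0 hornerM hornerX mulf_eq0 (negPf x0) orbF.
  rewrite horner_prod prodf_seq_eq0 => /orP[/eqP c0|/hasP[i _ /andP[xi]]].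
    by have : i0 \in [pred i | x i == x i0]; [rewrite inE | rewrite (card0_eq c0)].
  by rewrite hornerXsubC subr_eq0 eq_sym (negPf xi).
by move=> i /eqP ->.
Qed.

(* Separates finitely many nonzero vectors from 0 by one linear form of the
   shape (1, t, t^2, ...). *)
Lemma prod_moment_eq0 (K : numFieldType) (I J : finType) (v : I -> J -> K) :
    (forall t, \prod_i \sum_j t ^+ enum_rank j * v i j = 0) ->
  exists i, forall j, v i j = 0.
Proof.
move=> v0; apply: contrapT => no_i.
pose q i : {poly K} := \sum_j v i j *: 'X^(enum_rank j).
have q0 i : q i != 0.
  have [j vij] : exists j, v i j <> 0 by apply/existsNP => vi; apply: no_i; exists i.
  apply/eqP => /(congr1 (fun p : {poly K} => p`_(enum_rank j))); rewrite coef0 coef_sum.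
  rewrite (bigD1 j) //= coefZ coefXn eqxx mulr1 big1 ?addr0 // => j' neq_j.
  rewrite coefZ coefXn; case: eqP => [/val_inj/enum_rank_inj ej|];
    last by rewrite mulr0.
  by rewrite ej eqxx in neq_j.
have : \prod_i q i != 0 by apply/prodf_neq0 => i _.
case/eqP; apply: horner_inj => t; rewrite horner0 -(v0 t) horner_prod.
apply: eq_bigr => i _; rewrite horner_sum; apply: eq_bigr => j _.
by rewrite hornerZ hornerXn mulrC.
Qed.

Lemma perm_eq_enumP (T : finType) (s : seq T) : perm_eq s (enum T) ->
  exists p : {perm T}, s = map p (enum T).
Proof.
move=> ps; have sz := perm_size ps;
  have us : uniq s by rewrite (perm_uniq ps) enum_uniq.
pose g t := nth t s (index t (enum T)).
have lt_i t : (index t (enum T) < size s)%N by rewrite sz index_mem mem_enum.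
have g_inj : injective g.
  move=> t t' /eqP; rewrite /g (set_nth_default t t' (lt_i t')) nth_uniq //.
  by move=> /eqP/(congr1 (nth t (enum T))); rewrite !nth_index ?mem_enum.
exists (perm g_inj).
have [s0|[x0 _]] : s = [::] \/ exists x : T, true.
- by case: (s) => [|x ?]; [left | right; exists x].
- by have := sz; rewrite s0 => /esym/size0nil->.
apply: (@eq_from_nth _ x0) => [|i lt_is]; first by rewrite size_map.
rewrite (nth_map x0) -?sz // permE /g index_uniq ?enum_uniq -?sz //.
exact: set_nth_default.
Qed.

Section Eigenlines.
Variable K : fieldType.
Implicit Types (x y z : 'rV[K]_2) (M : 'M[K]_2).

Lemma row2_expand x y z :
  bracket x y *: z = bracket z y *: x - bracket z x *: y.
Proof. by apply: row2P; rewrite !mxE /bracket; ring. Qed.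

(** An eigenvector with non-zero components along the eigenvectors [x] and [y] forces their
    eigenvalues to agree. *)
Lemma three_eigenlines x y z M :
    bracket x y != 0 -> bracket x z != 0 -> bracket y z != 0 ->
    bracket (x *m M) x = 0 -> bracket (y *m M) y = 0 -> bracket (z *m M) z = 0 ->
  exists a, M = a%:M.
Proof.
have nz (u v : 'rV[K]_2) : bracket u v != 0 -> v != 0.
  by apply: contraNneq => ->; rewrite /bracket !mxE !mulr0 subrr.
move=> xy xz yz xM yM zM.
have [a xa] : exists a, x *m M = a *: x.
  by apply: (bracket0P _ xM); apply: (nz y); rewrite bracketC oppr_eq0.
have [b yb] := bracket0P (nz x y xy) yM.
have ab : a = b.
  have : bracket ((bracket x y *: z) *m M) z = 0 by rewrite -scalemxAl bracketZl zM mulr0.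
  rewrite row2_expand mulmxBl -!scalemxAl xa yb => zM'.
  have /eqP : bracket y z * bracket x z * (a - b) = 0.
    by rewrite -oppr0 -zM' /bracket !mxE; ring.
  by rewrite !mulf_eq0 (negPf yz) (negPf xz) subr_eq0 => /eqP.
exists a; apply/row_matrixP => i; rewrite !rowE; move: (delta_mx 0 i) => v.
apply: (scalerI xy); rewrite mul_mx_scalar scalerA [_ * a]mulrC -scalerA scalemxAl.
by rewrite row2_expand mulmxBl -!scalemxAl xa yb -ab scalerBr !scalerA ![a * _]mulrC.
Qed.

End Eigenlines.

(** * Invariants, closed orbit and finite isotropy group *)

Section Stability.
Variables (R : realType) (n : nat) (T : finType).
Local Notation C := R[i].
Local Notation d := (2 * n)%N.
Hypothesis cardT : #|T| = d.
Implicit Types (w l : T -> 'rV[C]_2) (B : 'M[C]_2).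

Definition brackets w (p : {perm T}) : C := bracket_prod w (map p (enum T)).

Lemma root_exists (k : nat) (c : C) : (0 < k)%N -> exists r, r ^+ k = c.
Proof.
move=> k_gt0; have [r] := @solve_monicpoly C k (fun i =>
  if i == 0%N then c else 0) k_gt0.
case: k k_gt0 => // k _; rewrite big_ord_recl /= expr0 mulr1 big1 ?addr0 => [|i _].
  by exists r.
by rewrite mul0r.
Qed.

Lemma prodformZ (r : T -> C) w :
  prodform (fun k => r k *: w k) = (\prod_k r k) *: prodform w.
Proof.
by rewrite /prodform -scaler_prod; apply: eq_bigr => k _; apply: linformZ.
Qed.

Lemma prodform_perm (s : {perm T}) w : prodform (fun k => w (s k)) = prodform w.
Proof. by rewrite /prodform [RHS](reindex_inj (@perm_inj _ s)). Qed.

Lemma forms_prodform_card w : forms d (prodform w).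
Proof. by rewrite -cardT; apply: forms_prodform. Qed.

Lemma act_prodform A w :
  act A (prodform w) = prodform (fun k => w k *m invmx A).
Proof.
rewrite /act rmorph_prod; apply: eq_bigr => k _; exact: linform_comp.
Qed.

Lemma form_prodform f : (0 < n)%N -> forms d f -> exists w, f = prodform w.
Proof.
move=> n_gt0 /form_factor[c [w [_ ->]]].
have [|r rc] := @root_exists d c; first by rewrite muln_gt0.
pose rank (k : T) := cast_ord cardT (enum_rank k).
exists (fun k => r *: w (rank k)); rewrite prodformZ prodr_const cardT rc;
  congr (_ *: _).
rewrite /prodform [LHS](reindex rank) //.
exists (fun i => enum_val (cast_ord (esym cardT) i)) => i _.
  by rewrite /rank cast_ordK enum_rankK.
by rewrite /rank enum_valK cast_ordKV.
Qed.

Lemma multihomog_brackets (s p : {perm T}) :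
  multihomog (fun=> 1%N) (fun w => brackets (fun k => w (s k)) p).
Proof.
have uE : uniq (map s (map p (enum T))).
  by rewrite !(map_inj_uniq (@perm_inj _ _)) enum_uniq.
rewrite (_ : (fun w => _) = fun w => bracket_prod w (map s (map p (enum T))));
  last first.
  by apply: funext => w; rewrite [RHS]bracket_prod_map.
rewrite (_ : (fun=> 1%N) = fun k => count_mem k (map s (map p (enum T)))).
  by apply: multihomog_bracket_prod; rewrite 2!size_map -cardE cardT mul2n odd_double.
apply: funext => k; rewrite count_uniq_mem //.
by rewrite -[k](permKV s) -[(s^-1)%g k](permKV p) !map_f ?mem_enum.
Qed.

Lemma bracketsM w B p : brackets (fun k => w k *m B) p = \det B ^+ n * brackets w p.
Proof. by apply: bracket_prodM; rewrite size_map -cardE cardT. Qed.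

Lemma brackets_comp w (s p : {perm T}) :
  brackets (fun k => w (s k)) p = brackets w (p * s).
Proof.
rewrite /brackets -[LHS](bracket_prod_map s w) -map_comp; congr bracket_prod.
by apply: eq_map => k; rewrite /= permM.
Qed.

(** Symmetrizing the [e]-th power of one bracket monomial gives the [e]-th power sum of all of them.
    A monomial has [n] brackets and each scales by the determinant, whence the weight [n * e]. *)
Lemma bracket_invariant (e : nat) : exists I : {mpoly C[d.+1]},
  (forall w, pvalue I (prodform w) = \sum_(s : {perm T}) brackets w s ^+ e) /\
  ((0 < n)%N -> relative_invariant I).
Proof.
have mh : multihomog (fun=> e) (fun w => brackets w 1 ^+ e).
  have := multihomogX e (multihomog_brackets 1 1).
  rewrite (_ : (fun k => _) = fun=> e); last by apply: funext => k; rewrite muln1.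
  rewrite (_ : (fun w => _) = fun w => brackets w 1 ^+ e) //.
  by apply: funext => w; rewrite brackets_comp mulg1.
have [I hI] := symmetrization cardT mh; exists I.
have IE w : pvalue I (prodform w) = \sum_(s : {perm T}) brackets w s ^+ e.
  by rewrite hI; apply: eq_bigr => s _; rewrite brackets_comp mul1g.
split=> // n_gt0; exists (n * e)%N => Q A hQ uA; have [w ->] := form_prodform n_gt0 hQ.
rewrite act_prodform !IE mulr_sumr; apply: eq_bigr => s _.
rewrite bracketsM exprMn exprM mulrA -!exprMn det_inv mulrV -?unitmxE //.
by rewrite expr1n mul1r.
Qed.

Variable l : T -> 'rV[C]_2.
Hypothesis l_neq0 : forall k, l k != 0.
Hypothesis small_classes :
  forall e, (#|[pred k | proj_point (l k) == e]| < n)%N.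

Let n_gt0 : (0 < n)%N := leq_ltn_trans (leq0n _) (small_classes None).
Let d_gt0 : (0 < d)%N. Proof. by rewrite muln_gt0. Qed.

Lemma exists_brackets : exists p, brackets l p != 0.
Proof.
have [x [y [_ [_ xy _ _]]]] := three_classes cardT l_neq0 small_classes.
have neq_xy : x != y by apply: contraNneq xy => ->; rewrite bracketvv.
have [s ps ds] := pairing_cons2 cardT small_classes neq_xy.
have [p sE] := perm_eq_enumP ps; exists p.
by rewrite /brackets -sE /= mulf_neq0 // bracket_prod_neq0.
Qed.

(* As t varies, these functions cut out the configurations some reordering of
   which has its vector of bracket monomials proportional to that of l. *)
Lemma orbit_equations (p0 : {perm T}) (t : C) : exists I : {mpoly C[d.+1]},
  forall w, pvalue I (prodform w) =
    #|{perm T}|%:R * \prod_(s : {perm T}) \sum_(p : {perm T}) t ^+ enum_rank p *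
      (brackets (fun k => w (s k)) p * brackets l p0 -
       brackets (fun k => w (s k)) p0 * brackets l p).
Proof.
pose G w (s : {perm T}) := \sum_(p : {perm T}) t ^+ enum_rank p *
      (brackets (fun k => w (s k)) p * brackets l p0 -
       brackets (fun k => w (s k)) p0 * brackets l p).
have mh : multihomog (fun=> #|{perm T}|) (fun w => \prod_s G w s).
  rewrite -[X in multihomog (fun=> X)]muln1; apply: multihomog_prod => s.
  apply: multihomog_sum => p; apply: multihomogZ.
  rewrite (_ : (fun w => _) = fun w =>
    brackets l p0 * brackets (fun k => w (s k)) p +
    (- brackets l p) * brackets (fun k => w (s k)) p0).
    by apply: multihomogD; apply: multihomogZ; apply: multihomog_brackets.
  by apply: funext => w; ring.
have [I hI] := symmetrization cardT mh; exists I => w; rewrite hI.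
(* The product over all reorderings is already symmetric, so symmetrization only multiplies it by
   the number of permutations. *)
rewrite (eq_bigr (fun=> \prod_s G w s)).
  by rewrite sumr_const mulr_natl.
move=> s _; rewrite [RHS](reindex_inj (mulIg s)); apply: eq_bigr => s' _.
by rewrite /G (_ : (fun k => w ((s' * s)%g k)) = fun k => w (s (s' k))) //;
  apply: funext => k; rewrite permM.
Qed.

Lemma orbit_closed (I : {mpoly C[d.+1]}) (e : nat) : (0 < e)%N ->
    (forall w, pvalue I (prodform w) = \sum_(s : {perm T}) brackets w s ^+ e) ->
    relative_invariant I -> pvalue I (prodform l) <> 0 ->
  zariski_closed_in d [set Q | forms d Q /\ pvalue I Q <> 0]%classic
    (orbit (prodform l)).
Proof.
move=> e_gt0 IE [k Ik] Il; have [p0 p0l] := exists_brackets.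
have [J JE] := choice (orbit_equations p0).
exists [set Q | forms d Q /\ forall J', range J J' -> pvalue J' Q = 0]%classic.
  by exists (range J).
apply/seteqP; split=> Q /=.
  case=> A uA ->; split; last split.
  - split; first by rewrite act_prodform; apply: forms_prodform_card.
    (* On the orbit all bracket monomials scale by the same power of a determinant, so the factor of
       the identity reordering vanishes. *)
    move=> _ [t _ <-]; rewrite act_prodform JE (bigD1 1%g) //= big1 ?mul0r ?mulr0 // => p _.
    rewrite !(bracketsM (fun k => l ((1%g : {perm T}) k))) !brackets_comp !mulg1.
    by rewrite [X in _ * X](_ : _ = 0) ?mulr0 //; ring.
  - by rewrite act_prodform; apply: forms_prodform_card.
  move=> act0; apply: Il; rewrite (Ik _ A) ?act0 ?mulr0 //; exact: forms_prodform_card.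
case=> -[hQ JQ] [_ IQ]; have [w QE] := form_prodform n_gt0 hQ.
(* The product over reorderings vanishes for all [t], which yields one reordering for which every
   equation holds. *)
have [s sE] : exists s : {perm T}, forall p,
    brackets (fun k => w (s k)) p * brackets l p0 -
    brackets (fun k => w (s k)) p0 * brackets l p = 0.
  pose v (s p : {perm T}) := brackets (fun k => w (s k)) p * brackets l p0 -
    brackets (fun k => w (s k)) p0 * brackets l p.
  apply: (@prod_moment_eq0 (R[i] : numFieldType) {perm T} {perm T} v) => t;
    have /eqP := JQ (J t) (imageT _ _).
  rewrite QE JE mulf_eq0 pnatr_eq0 => /orP[|/eqP //].
  by rewrite -leqn0 leqNgt => /negP[]; apply/card_gt0P; exists 1%g.
pose w' k := w (s k); have Qw' : Q = prodform w' by rewrite prodform_perm.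
pose c := brackets w' p0 / brackets l p0.
have cE p : brackets w' p = c * brackets l p.
  have /eqP := sE p; rewrite subr_eq0 => /eqP e1.
  by apply: (mulIf p0l); rewrite e1 /c mulrAC divfK.
have c_neq0 : c != 0.
  apply/eqP => c0; apply: IQ; rewrite Qw' IE big1 // => p _.
  by rewrite cE c0 mul0r expr0n eqn0Ngt e_gt0.
have eqs q : perm_eq q (enum T) -> bracket_prod w' q = c * bracket_prod l q.
  by move=> /perm_eq_enumP[p ->]; apply: cE.
have [B [r [uB rE]]] :=
  bracket_prod_rigid cardT l_neq0 small_classes c_neq0 eqs.
(* The matrix absorbs the product of the scalars [r k] through a [d]-th root. As [act] substitutes
   the inverse, the group element is the inverse of [a *: B]. *)
have [a aE] := root_exists (\prod_k r k) d_gt0.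
have a_neq0 : a != 0.
  apply: contraTneq (isT) => a0; move: aE; rewrite a0 expr0n eqn0Ngt d_gt0 /=.
  move/esym/eqP; rewrite prodf_seq_eq0 => /hasP[i _] /=.
  by have [/negPf->] := rE i.
have uaB : a *: B \in unitmx by rewrite unitmxZ // unitfE.
exists (invmx (a *: B)); first by rewrite unitmx_inv.
rewrite Qw' act_prodform invmxK.
transitivity (prodform (fun k => r k *: (l k *m B))).
  by congr prodform; apply: funext => i; have [_ ->] := rE i.
rewrite prodformZ -aE -cardT -prodr_const -prodformZ.
by congr prodform; apply: funext => i; rewrite -scalemxAr.
Qed.

(** An isotropy element carries each line of [l] to some line of [l]. Two elements compatible with
    the same map [g] of indices differ by a matrix that fixes three lines, hence by a scalar, and
    comparing their actions makes the scalar a [d]-th root of unity. *)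
Lemma isotropy_finite : finite_set (isotropy (prodform l)).
Proof.
pose S (g : {ffun T -> T}) : set 'M[C]_2 :=
  [set A | isotropy (prodform l) A /\ forall k,
    bracket (l k *m invmx A) (l (g k)) = 0]%classic.
apply: (@sub_finite_set _ _ (\bigcup_(g in [set: {ffun T -> T}]) S g)%classic).
  move=> A [uA]; rewrite act_prodform => lA.
  have ex k : exists j, bracket (l k *m invmx A) (l j) = 0.
    (* [z] is a zero of the linear form with coefficients [u], so some factor of [prodform l]
       vanishes there. *)
    pose u := l k *m invmx A;
      pose z : 'rV[C]_2 := \row_i (if i == 0 then u 0 1 else - u 0 0).
    have z0 : z 0 0 = u 0 1 by rewrite mxE.
    have z1 : z 0 1 = - u 0 0 by rewrite mxE.
    have /eqP : value (prodform l) z = 0.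
      by rewrite -lA value_prodform (bigD1 k) //= z0 z1 -/u mulrN (mulrC (u 0 1)) subrr mul0r.
    rewrite value_prodform prodf_seq_eq0 => /hasP[j _] /=; rewrite z0 z1 => /eqP lz.
    by exists j; rewrite -oppr0 -lz /bracket -/u; ring.
  have [g gE] := choice ex; exists (finfun g) => //; split.
    by split=> //; rewrite act_prodform.
  by move=> k; rewrite ffunE.
apply: bigcup_finite => // g _;
  have [-> //|/set0P[A0 [[uA0 A0l] A0g]]] := eqVneq (S g) set0.
have [rs rsE] := closed_field_poly_normal ('X^d - 1 : {poly C}).
apply: (@sub_finite_set _ _ ((fun r => r *: A0) @` [set` rs])%classic); last first.
  exact/finite_image/finite_seq.
move=> A [[uA Al] Ag].
have [x [y [z [_ xy xz yz]]]] := three_classes cardT l_neq0 small_classes.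
have par k : bracket (l k *m (invmx A *m A0)) (l k) = 0.
  rewrite mulmxA -[X in bracket _ X](mulmxKV uA0) bracketM.
  by rewrite (bracket0_trans (l_neq0 (g k)) (Ag k) (A0g k)) mulr0.
have [a aE] := three_eigenlines xy xz yz (par x) (par y) (par z).
have A0E : A0 = a *: A by rewrite -mul_mx_scalar -aE mulKVmx.
have a_neq0 : a != 0.
  apply: contraTneq uA0 => a0; rewrite A0E a0 scale0r unitmxE unitfE det0.
  by rewrite eqxx.
exists a^-1; last by rewrite /= A0E scalerA mulVf // scale1r.
rewrite /= -(root_prod_XsubC rs); have := rsE.
rewrite lead_coefDl ?size_polyXn ?size_polyN ?size_poly1 ?ltnS // lead_coefXn scale1r.
move=> <-; rewrite rootE !hornerE.
have l0 : prodform l != 0 by apply/prodf_neq0 => k _; apply: linform_neq0.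
have : (a^-1 ^+ d - 1) *: prodform l == 0; last by rewrite scaler_eq0 (negPf l0) orbF.
rewrite scalerBl scale1r subr_eq0 -{1}Al -[X in _ == X]A0l !act_prodform.
rewrite -cardT -prodr_const -prodformZ; apply/eqP.
congr prodform; apply: funext => k.
by rewrite scalemxAr -invmxZ -?A0E.
Qed.

Theorem stable_prodform : stable d (prodform l).
Proof.
split; first exact: isotropy_finite.
have [p0 p0l] := exists_brackets.
have [e e_gt0 sum_neq0] := power_sum_neq0 (x := brackets l) p0l.
have [I [IE /(_ n_gt0) Irel]] := bracket_invariant e.
have Il : pvalue I (prodform l) <> 0 by rewrite IE; apply/eqP.
exists I; split=> //; last exact: (orbit_closed e_gt0 IE).
(* In the zero configuration each bracket monomial has at least one factor, as [n] is positive, and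
   so vanishes. *)
exists (prodform l), (prodform (fun _ : T => 0)); split; try exact: forms_prodform_card.
rewrite [RHS]IE big1 // => p _; rewrite /brackets.
have : (0 < size (map p (enum T)))%N by rewrite size_map -cardE cardT.
have : ~~ odd (size (map p (enum T))) by rewrite size_map -cardE cardT mul2n odd_double.
case: (map _ _) => [|x [|y s]] //= _ _.
by rewrite bracketvv mul0r expr0n eqn0Ngt e_gt0.
Qed.

End Stability.

(** * The Milnor algebra *)

Section CoprimePair.
Variables (F : fieldType) (n : nat) (p1 p2 : {poly F}).
Hypothesis cop : coprimep p1 p2.
Hypothesis size1 : (size p1 <= n.+2)%N.
Hypothesis size2 : (size p2 <= n.+2)%N.
Hypothesis full : (size p1 == n.+2) || (size p2 == n.+2).

(** For [p1], [p2] dehomogenized from forms of degree [n + 1], this is the degree [k] part of the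
    ideal they generate: multipliers have degree at most [k - n - 1], and are zero if [k <= n]. *)
Definition bounded_comb (k : nat) (q : {poly F}) := exists a b : {poly F},
  [/\ (size a <= k - n)%N, (size b <= k - n)%N & q = a * p1 + b * p2].

Lemma bounded_comb_eq0 (k : nat) (q : {poly F}) : (k <= n)%N -> bounded_comb k q ->
  q = 0.
Proof.
rewrite -subn_eq0 => /eqP kn [a [b []]];
  rewrite kn !size_poly_leq0 => /eqP -> /eqP -> ->.
by rewrite !mul0r addr0.
Qed.

(** By coprimality the polynomial of full degree [n + 1] divides the multiplier of the other one,
    whose degree is at most [n]. *)
Lemma no_small_syzygy (h g : {poly F}) : (size h <= n.+1)%N -> (size g <= n.+1)%N ->
  h * p1 = g * p2 -> h = 0 /\ g = 0.
Proof.
have small (p q : {poly F}) : size p = n.+2 -> dvdp p q -> (size q <= n.+1)%N -> q = 0.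
  by move=> szp dvd_pq szq; apply: contraTeq dvd_pq => q0;
    apply/negP => /(dvdp_leq q0); rewrite szp leqNgt ltnS szq.
have nz (p : {poly F}) : size p = n.+2 -> p != 0 by rewrite -size_poly_gt0 => ->.
move=> szh szg e; case/orP: full => /eqP sz.
  have g0 : g = 0.
    by apply: (small p1) => //; rewrite -(Gauss_dvdpl _ cop) -e dvdp_mull.
  split=> //; move/eqP: e; rewrite g0 mul0r mulf_eq0 (negPf (nz _ sz)) orbF.
  by move/eqP.
have h0 : h = 0.
  have cop' : coprimep p2 p1 by rewrite coprimep_sym.
  by apply: (small p2) => //; rewrite -(Gauss_dvdpl _ cop') e dvdp_mull.
split=> //; move/eqP: e; rewrite h0 mul0r eq_sym mulf_eq0 (negPf (nz _ sz)) orbF.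
by move/eqP.
Qed.

(** In a Bezout relation, reduce the multiplier of one polynomial modulo the other, chosen of full
    degree; a degree count then bounds the remaining multiplier. *)
Lemma bounded_bezout (q : {poly F}) : (size q <= (2 * n).+2)%N ->
  bounded_comb (2 * n).+1 q.
Proof.
move=> szq; have kE : ((2 * n).+1 - n = n.+1)%N by lia.
rewrite /bounded_comb kE.
have [[u v] /= uv] := Bezout_eq1_coprimepP p1 p2 cop.
have {uv} qE : q = (q * u) * p1 + (q * v) * p2 by rewrite -!mulrA -mulrDr uv mulr1.
have reduce (r s a b : {poly F}) : size r = n.+2 -> (size s <= n.+2)%N ->
  q = a * r + b * s ->
    exists a' b' : {poly F}, [/\ (size a' <= n.+1)%N,
      (size b' <= n.+1)%N & q = a' * r + b' * s].
  move=> szr szs e; have r0 : r != 0 by rewrite -size_poly_gt0 szr.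
  have szb : (size (modp b r) <= n.+1)%N by rewrite -ltnS -szr ltn_modp.
  have qE' : q = (a + (divp b r) * s) * r + (modp b r) * s.
    by rewrite e {1}(divp_eq b r); ring.
  exists (a + (divp b r) * s), (modp b r); split=> //; set c := a + _.
  have [->|c0] := eqVneq c 0; first by rewrite size_poly0.
  have : (size (c * r)%R <= (2 * n).+2)%N.
    have -> : c * r = q - (modp b r) * s by rewrite {1}qE' addrK.
    rewrite (leq_trans (size_polyD _ _)) // geq_max szq size_polyN.
    apply: leq_trans (size_polyMleq _ _) _; have := leq_add szb szs.
    by case: (size _ + _)%N => [|x] /=; lia.
  by rewrite size_mul // szr addnS /= (_ : (2 * n).+2 = n.+1 + n.+1)%N ?leq_add2r //; lia.
case/orP: full => /eqP sz; first exact: (reduce p1 p2 _ _ sz size2 qE).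
rewrite addrC in qE; have [a [b [sza szb e]]] := reduce p2 p1 _ _ sz size1 qE.
by exists b, a; split; rewrite // addrC.
Qed.

(* If X q = a p1 + b p2 and q = a' p1 + b' p2, the difference is a syzygy too
   small to be nontrivial, whence a = X a' and b = X b'. *)
Lemma bounded_comb_descent (k : nat) (q : {poly F}) : (k < 2 * n)%N ->
  bounded_comb k.+1 ('X * q) -> bounded_comb k.+1 q -> bounded_comb k q.
Proof.
move=> lt_k [a [b [sza szb e]]] [a' [b' [sza' szb' e']]].
have sz_mulX (p : {poly F}) : (size p <= k.+1 - n)%N -> (size ('X * p)%R <= n.+1)%N.
  have [->|p0] := eqVneq p 0; first by rewrite mulr0 size_poly0.
  by rewrite mulrC size_mulX //; lia.
have szD (p r : {poly F}) : (size p <= k.+1 - n)%N -> (size r <= k.+1 - n)%N ->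
    (size ('X * p - r)%R <= n.+1)%N.
  move=> szp szr; rewrite (leq_trans (size_polyD _ _)) // geq_max size_polyN sz_mulX //=.
  by rewrite (leq_trans szr) //; lia.
have [||/subr0_eq aE /eqP] :=
    @no_small_syzygy ('X * a' - a) (- ('X * b' - b)) (szD _ _ sza' sza).
- by rewrite size_polyN szD.
- by move/eqP: e; rewrite e' -subr_eq0 => /eqP e; apply/eqP; rewrite -subr_eq0 -e;
  apply/eqP; ring.
rewrite oppr_eq0 => /eqP/subr0_eq bE.
have small (p r : {poly F}) : 'X * p = r -> (size r <= k.+1 - n)%N ->
  (size p <= k - n)%N.
  have [->|p0] := eqVneq p 0; first by rewrite size_poly0.
  by move=> <-; rewrite mulrC size_mulX //; lia.
by exists a', b'; split=> //; [apply: small aE _ | apply: small bE _].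
Qed.

End CoprimePair.

Section Derivatives.
Variable R : realType.
Local Notation C := R[i].
Implicit Types (f : {mpoly C[2]}) (a b z : 'rV[C]_2).

Lemma forms_mderiv d i f : forms d.+1 f -> forms d f^`M(i).
Proof.
move=> hf; apply/dhomogP => m; rewrite mcoeff_msupp mcoeff_deriv /= => m0.
apply/eqP; rewrite -eqSS; apply: contraNT m0 => md.
by rewrite (dhomog_nemf_coeff hf) ?mul0rn // /= mdegD mdeg1 addn1.
Qed.

Lemma value_scale d f t z : forms d f -> value f (t *: z) = t ^+ d * value f z.
Proof.
move=> /formE ->; rewrite /value !raddf_sum mulr_sumr; apply: eq_bigr => k _ /=.
rewrite !mevalZ /xpow !mevalM !rmorphXn /= !mevalXU !mxE !exprMn.
have -> : t ^+ d = t ^+ k * t ^+ (d - k) by rewrite -exprD subnKC // leq_ord.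
by rewrite (mulrACA (t ^+ k)) [LHS]mulrCA.
Qed.

(** This replaces the multipliers in an ideal membership by homogeneous ones; for [k < e] the bound
    says that the dehomogenized multiplier is zero. *)
Lemma homog_part_mul e k (a g : {mpoly C[2]}) : forms e g -> exists2 a' : {mpoly C[2]},
  (size (dehom a') <= k.+1 - e)%N & pihomog mdeg k (a * g) = a' * g.
Proof.
move=> hg; have piM i (f : {mpoly C[2]}) : forms i f ->
  pihomog mdeg k (f * g) = if (i + e == k)%N then f * g else 0.
  move=> hf; have hfg := forms_mul hf hg; case: eqP => [<-|/eqP ne].
    exact: pihomog_dE.
  exact: pihomog_ne0 ne hfg.
have aE := pihomog_partitionE (leqnn (msize a)).
have homi i : forms i (pihomog mdeg i a) by apply: pihomogP.
exists (\sum_(i < msize a | (i + e == k)%N) pihomog mdeg i a); last first.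
  rewrite {1}aE mulr_suml raddf_sum mulr_suml [RHS]big_mkcond.
  by apply: eq_bigr => i _; apply: piM.
rewrite rmorph_sum (leq_trans (size_sum _ _ _)) //; apply/bigmax_leqP => i /eqP ik /=.
by rewrite (leq_trans (size_dehom (homi i))) // -ik; lia.
Qed.

End Derivatives.

Lemma value_lead_coef (R : realType) d (f : {mpoly R[i][2]}) : forms d f ->
  value f (delta_mx 0 0) = (dehom f)`_d.
Proof.
move=> hf; rewrite (dehomE hf) coef_poly ltnSn {1}(formE hf) /value raddf_sum /=.
rewrite big_ord_recr /= big1 ?add0r => [|k _];
  rewrite mevalZ /xpow mevalM !rmorphXn /= !mevalXU !mxE /=.
  by rewrite subnn expr0 expr1n !mulr1.
by rewrite expr0n subn_eq0 leqNgt ltn_ord !mulr0.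
Qed.

(** * Vanishing above degree [2 * n] and duality below it *)

Section MilnorAlgebra.
Variables (R : realType) (n : nat) (hm : (3 <= n.+2)%N) (Q : X2 R n.+2).
Local Notation C := R[i].
Local Notation cls := (mcls hm Q).
Local Notation Q_ i := ((X2_form Q)^`M(i)).
Implicit Types (p : {mpoly C[2]}) (u v z : 'rV[C]_2).

Lemma mcls_eq0 p : cls p = 0 <-> exists a b, p = a * Q_ 0 + b * Q_ 1.
Proof.
have -> : 0 = cls 0 by rewrite /mcls raddf0.
split=> [/eqP|[a [b pE]]].
  by rewrite -[_ == _]Quotient.idealrBE subr0 => /asboolP.
apply/eqP; rewrite -[_ == _]Quotient.idealrBE subr0; apply/asboolP.
by exists a, b.
Qed.

Lemma forms_partial i : forms n.+1 (Q_ i).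
Proof. exact: forms_mderiv (X2_homog Q). Qed.

Lemma partials_not_both0 z : z != 0 -> value (Q_ 0) z = 0 -> value (Q_ 1) z = 0 ->
  False.
Proof. by move=> z0 e0 e1; apply: (X2_disc (x := Q) z0). Qed.

Lemma partials_coprime : coprimep (dehom (Q_ 0)) (dehom (Q_ 1)).
Proof.
apply: Pdiv.ClosedField.root_coprimep => x /rootP; rewrite /dehom !value_on_line => e0.
apply/eqP => e1; apply: partials_not_both0 e0 e1; apply/eqP => /rowP/(_ 1).
by rewrite !mxE /= mulr0 add0r => /eqP; rewrite oner_eq0.
Qed.

(** The point [(1, 0)] is not a common zero of the partial derivatives, and their values there are
    the coefficients of degree [n + 1]. *)
Lemma partials_full :
  (size (dehom (Q_ 0)) == n.+2) || (size (dehom (Q_ 1)) == n.+2).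
Proof.
have lead i : value (Q_ i) (delta_mx 0 0) != 0 -> size (dehom (Q_ i)) == n.+2.
  rewrite (value_lead_coef (forms_partial i)) => nz.
  rewrite eqn_leq (size_dehom (forms_partial i)) /= ltnNge.
  by apply: contra nz => le_sz; rewrite nth_default.
apply/orP; have [e0|/lead] := eqVneq (value (Q_ 0) (delta_mx 0 0)) 0; last by left.
have [e1|/lead] := eqVneq (value (Q_ 1) (delta_mx 0 0)) 0; last by right.
case: (partials_not_both0 _ e0 e1); apply/eqP => /rowP/(_ 0).
by rewrite !mxE /= => /eqP; rewrite oner_eq0.
Qed.

(** The ideal is generated by forms, so a relation for [p] can be cut down to its part of degree [k]
    and dehomogenized; conversely, bounded multipliers are homogenized. *)
Lemma mcls_form_eq0 k p : forms k p ->
  cls p = 0 <-> bounded_comb n (dehom (Q_ 0)) (dehom (Q_ 1)) k (dehom p).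
Proof.
move=> hp; split=> [/mcls_eq0[a [b pE]]|pQ].
  have [a' sza aE] := homog_part_mul k a (forms_partial 0).
  have [b' szb bE] := homog_part_mul k b (forms_partial 1).
  exists (dehom a'), (dehom b'); split=> //.
  by rewrite -!dehomM -aE -bE -dehomD -raddfD -pE /= (pihomog_dE hp).
have [lt_nk|le_kn] := ltnP n k; last first.
  have -> : p = 0.
    apply: (dehom_inj hp (dhomog0 _ _ _)).
    by rewrite (bounded_comb_eq0 le_kn pQ) dehom0.
  by rewrite /mcls raddf0.
case: pQ => a [b [sza szb pE]]; apply/mcls_eq0.
have kE : k = ((k - n.+1) + n.+1)%N by rewrite subnK.
have szE : (k - n = (k - n.+1).+1)%N by lia.
rewrite szE in sza szb.
exists (hom_form (k - n.+1) a), (hom_form (k - n.+1) b).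
apply: (dehom_inj hp).
  rewrite {1}kE; apply: forms_add; apply: forms_mul;
    by [apply: forms_hom | apply: forms_partial].
rewrite dehomD (dehomM (hom_form _ a)) (dehomM (hom_form _ b)).
by rewrite (dehom_hom sza) (dehom_hom szb).
Qed.

Let sz i : (size (dehom (Q_ i)) <= n.+2)%N.
Proof. exact: size_dehom (forms_partial i). Qed.

Lemma mcls_degree_gt p : forms (2 * n).+1 p -> cls p = 0.
Proof.
move=> hp; apply/(mcls_form_eq0 hp).
by apply: (bounded_bezout partials_coprime (sz 0) (sz 1) partials_full);
  apply: size_dehom.
Qed.

Lemma mcls_descent k p : (k < 2 * n)%N -> forms k p ->
  cls ('X_0 * p) = 0 -> cls ('X_1 * p) = 0 -> cls p = 0.
Proof.
move=> lt_k hp e0 e1; apply/(mcls_form_eq0 hp).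
have hX i : forms k.+1 ('X_i * p).
  by rewrite -add1n; apply: forms_mul => //; rewrite /forms /= dhomogX /= mdeg1.
move/(mcls_form_eq0 (hX 0)): e0; move/(mcls_form_eq0 (hX 1)): e1.
rewrite !dehomM dehomX0 dehomX1 mul1r => e1 e0.
exact: (bounded_comb_descent partials_coprime (sz 0) (sz 1) partials_full lt_k e0 e1).
Qed.

Lemma mcls_linform_span u v p : bracket u v != 0 ->
  cls (linform u * p) = 0 -> cls (linform v * p) = 0 ->
  cls ('X_0 * p) = 0 /\ cls ('X_1 * p) = 0.
Proof.
move=> uv; rewrite !mclsM.
have comb (a b : C) f : f = a *: linform u + b *: linform v ->
    cls (linform u) * cls p = 0 -> cls (linform v) * cls p = 0 -> cls f * cls p = 0.
  move=> -> eu ev; rewrite mclsD -!mul_mpolyC !mclsM mulrDl -!mulrA eu ev.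
  by rewrite !mulr0 addr0.
have eqform f g : forms 1 f -> forms 1 g -> value f =1 value g ->
  f = g by apply: form_value_inj.
have hX i : forms 1 ('X_i : {mpoly C[2]}) by rewrite /forms /= dhomogX /= mdeg1.
have hc (a b : C) : forms 1 (a *: linform u + b *: linform v).
  by apply: forms_add; apply: forms_scale; apply: forms_linform.
move=> eu ev; split.
- apply: (comb (v 0 1 / bracket u v) (- u 0 1 / bracket u v)) => //.
  apply: eqform => // z;
    rewrite /value mevalD !mevalZ mevalXU -!/(value _ z) !value_linform.
  by apply: (mulIf uv); rewrite /bracket in uv *; field.
- apply: (comb (- v 0 0 / bracket u v) (u 0 0 / bracket u v)) => //.
  apply: eqform => // z;
    rewrite /value mevalD !mevalZ mevalXU -!/(value _ z) !value_linform.
  by apply: (mulIf uv); rewrite /bracket in uv *; field.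
Qed.

(* Gorenstein duality in the form: only zero is killed by a component of
   degree at most the complementary one. *)
Lemma mcls_descent_linforms u v e r p : bracket u v != 0 -> forms e p ->
    (e + r <= 2 * n)%N ->
    (forall j, (j <= r)%N -> cls (linform u ^+ j * linform v ^+ (r - j) * p) = 0) ->
  cls p = 0.
Proof.
move=> uv hp; elim: r => [|r IHr] le_er h0.
  by have := h0 0%N isT; rewrite !expr0 !mul1r.
have hpow w k : forms k (linform w ^+ k).
  by rewrite -[X in forms X]mul1n; apply: dhomogMn; apply: forms_linform.
apply: IHr => [|j le_jr]; first by lia.
(* The products of [q] with the two linear forms are instances of the hypothesis in degree [r.+1],
   so both variables kill the class of [q]. *)
set q := _ * p; have hq : forms (e + r) q.
  rewrite addnC /q; apply: forms_mul => //; rewrite -{1}(subnKC le_jr).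
  by apply: forms_mul; apply: hpow.
have [||e0 e1] := @mcls_linform_span u v q uv.
- by have := h0 j.+1 le_jr; rewrite subSS exprS !mulrA.
- by have := h0 j (leqW le_jr); rewrite subSn // exprS /q !mulrA (mulrC (linform v)).
apply: (mcls_descent _ hq) => //; lia.
Qed.

Lemma socle_form p : (0 < n)%N -> forms (2 * n) p -> socle (cls p).
Proof.
move=> n_gt0 hp; have n2 : (0 < 2 * n)%N by rewrite muln_gt0.
split.
  have [c [a [b pE]]] := mpoly_decomp p.
  have c0 : c = 0.
    have := value_scale 0 0 hp; rewrite scale0r expr0n eqn0Ngt n2 mul0r pE /value.
    by rewrite !mevalD !mevalM mevalC !mevalXU !mxE !mulr0 !addr0.
  exists (cls a), (cls b); rewrite pE c0 mpolyC0 add0r mclsD !mclsM //.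
move=> _ [a [b ->]]; have kill i : cls p * e_ hm Q i = 0.
  rewrite /e_ -mclsM; apply: mcls_degree_gt; rewrite -addn1; apply: forms_mul => //.
  by rewrite /forms /= dhomogX /= mdeg1.
by rewrite mulrDr ![cls p * (_ * _)]mulrCA !kill !mulr0 addr0.
Qed.

Lemma mclsZ c p : cls (c *: p) = c *: cls p.
Proof. by rewrite -mul_mpolyC mclsM. Qed.

Lemma e_linform z : z 0 0 *: e_ hm Q 0 + z 0 1 *: e_ hm Q 1 = cls (linform z).
Proof. by rewrite /linform mclsD !mclsZ. Qed.

Section Omega.
Variable omega : milnor hm Q -> C.
Hypothesis om : is_omega omega.
Hypothesis n_gt0 : (0 < n)%N.

Lemma socle0 : socle (0 : milnor hm Q).
Proof.
split; last by move=> y _; rewrite mul0r.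
by exists 0, 0; rewrite !mul0r addr0.
Qed.

Lemma omega0 : omega 0 = 0.
Proof.
case: om => lin _ _; have := lin 1 0 0 socle0 socle0.
by rewrite scale1r addr0 mul1r => /eqP;
  rewrite -subr_eq0 opprD addrA subrr sub0r oppr_eq0 => /eqP.
Qed.

Lemma omega_form_eq0 p : forms (2 * n) p -> omega (cls p) = 0 -> cls p = 0.
Proof.
move=> hp e; have [_ [_ inj _] _] := om.
by apply: inj; rewrite ?inE ?omega0 //; [apply: socle_form | apply: socle0].
Qed.

Lemma omega_sum (I : Type) (r : seq I) (c : I -> C) (p : I -> {mpoly C[2]}) :
  (forall i, forms (2 * n) (p i)) ->
  omega (cls (\sum_(i <- r) c i *: p i)) = \sum_(i <- r) c i * omega (cls (p i)).
Proof.
move=> hp; elim: r => [|i r IHr]; first by rewrite !big_nil /mcls raddf0 omega0.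
rewrite !big_cons mclsD mclsZ; case: om => -> //; rewrite ?IHr //.
  exact: socle_form.
by apply: socle_form => //; apply: forms_sum => j _; apply: forms_scale.
Qed.

End Omega.
End MilnorAlgebra.

(** * The associated form *)

Lemma deriv_monomial (K : numFieldType) (p : {poly K}) (k : K) (j : nat) :
  p^`() = k *: 'X^j -> forall s, p.[s] = p.[0] + k / j.+1%:R * s ^+ j.+1.
Proof.
move=> dp s; have j1 : (j.+1%:R : K) != 0 by rewrite pnatr_eq0.
have pE i : p`_i.+1 = (k / j.+1%:R) *+ (i == j).
  have := congr1 (fun q : {poly K} => q`_i) dp.
  rewrite coef_deriv coefZ coefXn => e; apply: (@mulIf _ i.+1%:R);
    first by rewrite pnatr_eq0.
  rewrite mulr_natr e; have [->|_] := eqVneq i j; last by rewrite mulr0 mulr0n mul0r.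
  by rewrite mulr1n divfK // mulr1.
have -> : p = (p`_0)%:P + (k / j.+1%:R) *: 'X^(j.+1).
  apply/polyP => -[|i]; rewrite coefD coefC coefZ coefXn /=;
    first by rewrite mulr0 addr0.
  by rewrite pE eqSS add0r mulr_natr.
by rewrite !hornerE expr0n /= mulr0 addr0.
Qed.

Lemma lin_solve2 (K : fieldType) (a b : 'rV[K]_2) (x y : K) : bracket a b != 0 ->
  a 0 0 * x + a 0 1 * y = 0 -> b 0 0 * x + b 0 1 * y = 0 -> x = 0 /\ y = 0.
Proof.
move=> ab ea eb; split; apply: (mulIf ab); rewrite mul0r.
  transitivity (b 0 1 * (a 0 0 * x + a 0 1 * y) - a 0 1 * (b 0 0 * x + b 0 1 * y)).
    by rewrite /bracket; ring.
  by rewrite ea eb !mulr0 subrr.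
transitivity (a 0 0 * (b 0 0 * x + b 0 1 * y) - b 0 0 * (a 0 0 * x + a 0 1 * y)).
  by rewrite /bracket; ring.
by rewrite ea eb !mulr0 subrr.
Qed.

(** * Reduction of [Q] to a sum of two powers *)

Section NormalForm.
Variables (R : realType) (n : nat) (hm : (3 <= n.+2)%N) (Q : X2 R n.+2).
Hypothesis n_gt0 : (0 < n)%N.
Local Notation C := R[i].
Local Notation cls := (mcls hm Q).
Local Notation Q_ i := ((X2_form Q)^`M(i)).
Implicit Types (p : {mpoly C[2]}) (u v z c d : 'rV[C]_2).

Lemma valueX p k z : value (p ^+ k) z = value p z ^+ k.
Proof. exact: rmorphXn. Qed.

Lemma value_linform_dot u z : value (linform u) z = dot u z.
Proof. exact: value_linform. Qed.

Lemma deriv_on_line_value a b p s : (on_line a b p)^`().[s] =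
  a 0 0 * value p^`M(0) (s *: a + b) + a 0 1 * value p^`M(1) (s *: a + b).
Proof. exact: horner_deriv_on_line. Qed.

Lemma no_critical_point z a b : z != 0 -> bracket a b != 0 ->
  a 0 0 * value (Q_ 0) z + a 0 1 * value (Q_ 1) z = 0 ->
  b 0 0 * value (Q_ 0) z + b 0 1 * value (Q_ 1) z = 0 -> False.
Proof.
move=> z0 ab ea eb; have [e0 e1] := lin_solve2 ab ea eb.
exact: partials_not_both0 z0 e0 e1.
Qed.

Lemma forms_linformX u k : forms k (linform u ^+ k).
Proof. by rewrite -[X in forms X]mul1n; apply: dhomogMn; apply: forms_linform. Qed.

(** In degree [n + 1], that of the partial derivatives, the multipliers are constants. *)
Lemma linform_power_partials v : cls (linform v ^+ n.+1) = 0 ->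
  exists c, linform v ^+ n.+1 = c 0 0 *: Q_ 0 + c 0 1 *: Q_ 1.
Proof.
move/(mcls_form_eq0 hm Q (forms_linformX v n.+1)) => [a [b []]]; rewrite subSnn.
move=> /size1_polyC -> /size1_polyC -> e.
exists (\row_j (if j == 0 then a`_0 else b`_0)); rewrite !mxE /=.
apply: (dehom_inj (forms_linformX v n.+1)).
  by apply: forms_add; apply: forms_scale; apply: forms_partial.
by rewrite e dehomD !dehomZ !mul_polyC.
Qed.

(* Some directional derivative of Q is the m-1-st power of a linear form, and
   one integrates along that direction. *)
Lemma Fermat_coordinates v : v != 0 -> cls (linform v ^+ n.+1) = 0 ->
  exists c d (x y : C), [/\ bracket c d != 0, x != 0, y != 0 &
    forall s t, value Q (s *: c + t *: d) = x * s ^+ n.+2 + y * t ^+ n.+2].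
Proof.
move=> v0 /linform_power_partials[c cE].
have c0 : c != 0.
  apply: contraNneq (expf_neq0 n.+1 (linform_neq0 v0)) => c0.
  by rewrite cE c0 !mxE !scale0r addr0.
have dc z : (on_line c z Q)^`() = (dot v c *: 'X + (dot v z)%:P) ^+ n.+1.
  by rewrite deriv_on_line -!on_lineZ -on_lineD -cE rmorphXn /= on_line_linform.
have gradc z : c 0 0 * value (Q_ 0) z + c 0 1 * value (Q_ 1) z = dot v z ^+ n.+1.
  rewrite -value_linform_dot -valueX cE /value mevalD !mevalZ //.
(* If the linear form vanishes at [c], then [Q] is affine along [c]; expanding around [c] in a
   transverse direction [w] shows that [c] is a critical point of [Q], which is excluded. *)
have [vc|vc] := eqVneq (dot v c) 0.
  have [w vw] := exists_dot_neq0 v0.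
  have w0 : w != 0 by apply: contraNneq vw => ->; rewrite /dot !mxE !mulr0 addr0.
  have cw : bracket c w != 0.
    apply: contraNneq c0 => /(bracket0P w0)[a ca].
    have : dot v c = a * dot v w by rewrite ca /dot !mxE; ring.
    by rewrite vc => /esym/eqP; rewrite mulf_eq0 (negPf vw) orbF ca => /eqP ->;
      rewrite scale0r.
  have Qcw s : value Q (s *: c + w) = value Q w + dot v w ^+ n.+1 * s.
    have dQ : (on_line c w Q)^`() = (dot v w ^+ n.+1) *: 'X^0.
      by rewrite dc vc scale0r add0r expr0 -polyC_exp alg_polyC.
    have := deriv_monomial dQ s; rewrite !value_on_line scale0r add0r.
    by rewrite divr1 expr1.
  case: (no_critical_point c0 cw); first by rewrite gradc vc expr0n.
  have PE : on_line w c Q = value Q w *: 'X^(n.+2) + (dot v w ^+ n.+1) *: 'X^(n.+1).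
    (* The factor ['X] settles [t = 0]; elsewhere homogeneity rescales the point. *)
    apply: (@mulfI _ 'X); first by rewrite polyX_eq0.
    apply: horner_inj => t; have [->|t0] := eqVneq t 0.
      by rewrite !hornerM hornerX !mul0r.
    rewrite !hornerM hornerX; congr (_ * _); rewrite value_on_line.
    have -> : t *: w + c = t *: (t^-1 *: c + w).
      by rewrite scalerDr scalerA mulfV // scale1r addrC.
    rewrite (value_scale _ _ (X2_homog Q)) Qcw hornerD !hornerZ !hornerXn mulrDr.
    congr (_ + _); first exact: mulrC.
    by rewrite exprSr -mulrA (mulrCA t) mulfV // mulr1 mulrC.
  have := deriv_on_line_value w c Q 0; rewrite scale0r add0r => <-.
  rewrite PE derivD !derivZ !derivXn hornerD !hornerZ !hornerMn !hornerXn.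
  by rewrite !expr0n /= eqn0Ngt n_gt0 !mul0rn !mulr0 addr0.
(* The linear form vanishes at [d], so the derivative of [Q] along [c] at [s *: c + t *: d] is a
   multiple of [s ^+ n.+1] that does not depend on [t]. *)
pose d := perp v; have vd : dot v d = 0 by rewrite /dot !mxE /=; ring.
have cd : bracket c d != 0 by rewrite bracket_perpr oppr_eq0.
have d0 : d != 0.
  by apply: contraNneq cd => ->; rewrite /bracket !mxE !mulr0 subrr.
pose x := dot v c ^+ n.+1 / n.+2%:R.
have Qcd s t : value Q (s *: c + t *: d) = x * s ^+ n.+2 + value Q d * t ^+ n.+2.
  have dQ : (on_line c (t *: d) Q)^`() = (dot v c ^+ n.+1) *: 'X^(n.+1).
    rewrite dc (_ : dot v (t *: d) = 0) ?addr0 ?exprZn //.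
    by transitivity (t * dot v d); [rewrite /dot !mxE; ring | rewrite vd mulr0].
  have := deriv_monomial dQ s; rewrite !value_on_line scale0r add0r => ->.
  by rewrite (value_scale _ _ (X2_homog Q)) addrC mulrC [X in _ + X]mulrC.
exists c, d, x, (value Q d); split=> //.
  by rewrite mulf_neq0 ?expf_neq0 // invr_eq0 pnatr_eq0.
(* Otherwise [d] is a critical point: the derivative along [c] is zero there, and [Q] vanishes on
   the line of [d]. *)
apply/eqP => Qd; case: (no_critical_point d0 cd); first by rewrite gradc vd expr0n.
have P0 : on_line d 0 Q = 0.
  apply: horner_inj => s.
  by rewrite value_on_line addr0 (value_scale _ _ (X2_homog Q)) Qd mulr0 horner0.
have := deriv_on_line_value d 0 Q 1; rewrite scale1r addr0 => <-.
by rewrite P0 deriv0 horner0.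
Qed.

End NormalForm.

Section LinearEquivalence.
Variable R : realType.
Local Notation C := R[i].
Implicit Types (f g : {mpoly C[2]}) (u v z : 'rV[C]_2).

Lemma forms_act d A f : forms d f -> forms d (act A f).
Proof.
move=> /form_factor[c [w [_ ->]]].
rewrite /act comp_mpolyZ; apply: forms_scale; rewrite -/(act A _) act_prodform.
by rewrite -[X in forms X]card_ord; apply: forms_prodform.
Qed.

Lemma lin_equiv_value d f g (M : 'M[C]_2) : forms d f -> forms d g -> M \in unitmx ->
  (forall z, value g z = value f (z *m M)) -> lin_equiv f g.
Proof.
move=> hf hg uM gE; have uA : invmx M^T \in unitmx by rewrite unitmx_inv unitmx_tr.
exists (invmx M^T) => //; apply: (form_value_inj hg (forms_act _ hf)) => z.
by rewrite value_act invmxK trmxK.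
Qed.

Definition rows2 u v : 'M[C]_2 := \matrix_(i, j) (if i == 0 then u 0 j else v 0 j).

Lemma mul_rows2 u v z : z *m rows2 u v = z 0 0 *: u + z 0 1 *: v.
Proof. by apply: row2P; rewrite mulmx2E !mxE. Qed.

Lemma rows2_unit u v : bracket u v != 0 -> rows2 u v \in unitmx.
Proof. by rewrite unitmxE unitfE det2E !mxE. Qed.

Lemma dot_rows2 u v z : z *m (rows2 u v)^T = \row_j (if j == 0 then dot z u else dot z v).
Proof. by apply: row2P; rewrite mulmx2E !mxE. Qed.

End LinearEquivalence.

(** * The associated form and powers of linear forms in the Milnor algebra *)

Section AssociatedForm.
Variables (R : realType) (n : nat) (hm : (3 <= n.+2)%N) (Q : X2 R n.+2).
Hypothesis n_gt0 : (0 < n)%N.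
Local Notation C := R[i].
Local Notation cls := (mcls hm Q).
Local Notation Q_ i := ((X2_form Q)^`M(i)).
Implicit Types (p : {mpoly C[2]}) (u v z : 'rV[C]_2).
Variable omega : milnor hm Q -> C.
Hypothesis om : is_omega omega.

Lemma forms_mixed u v i : (i <= 2 * n)%N ->
  forms (2 * n) (linform u ^+ (2 * n - i) * linform v ^+ i).
Proof.
move=> le_i; rewrite -[X in forms X](subnK le_i).
by apply: forms_mul; apply: forms_linformX.
Qed.

Lemma omega_binomial u v (a b : C) :
  omega (cls ((a *: linform u + b *: linform v) ^+ (2 * n))) =
  \sum_(i < (2 * n).+1) (a ^+ (2 * n - i) * b ^+ i *+ 'C(2 * n, i)) *
     omega (cls (linform u ^+ (2 * n - i) * linform v ^+ i)).
Proof.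
rewrite exprDn -(omega_sum om n_gt0) => [|i]; last by apply: forms_mixed; rewrite -ltnS.
congr (omega (cls _)); apply: eq_bigr => i _.
by rewrite !exprZn -scalerAl -scalerAr scalerA scalerMnl.
Qed.

(** Up to a binomial coefficient, the coefficient of ['X^(2 * n - i)] is [c i], so divisibility by
    ['X^n] kills [c i] for [i > n]. The classes involved are the products of [linform v ^+ n.+1]
    with a spanning set in the complementary degree [n - 1]. *)
Lemma power_in_ideal u v (BQ : {mpoly C[2]}) (g : {poly C}) : bracket u v != 0 ->
    (forall z, value BQ z = omega (cls (linform z ^+ (2 * n)))) ->
    on_line u v BQ = 'X^n * g ->
  cls (linform v ^+ n.+1) = 0.
Proof.
move=> uv BQE BQg.
pose c i := omega (cls (linform u ^+ (2 * n - i) * linform v ^+ i)).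
have PE : on_line u v BQ = \sum_(i < (2 * n).+1) (c i *+ 'C(2 * n,
  i)) *: 'X^(2 * n - i).
  apply: horner_inj => s; rewrite value_on_line BQE horner_sum.
  have -> : linform (s *: u + v) = s *: linform u + 1 *: linform v.
    by rewrite linformD linformZ scale1r.
  rewrite omega_binomial; apply: eq_bigr => i _.
  by rewrite expr1n mulr1 hornerZ hornerXn mulrnAl [RHS]mulrC mulrnAr.
have c0 i : (n < i <= 2 * n)%N -> c i = 0.
  move=> /andP[lt_ni le_i]; have := congr1 (fun q : {poly C} => q`_(2 * n - i)) BQg.
  rewrite PE coefXnM ifT; last by lia.
  rewrite coef_sum (bigD1 (Ordinal (le_i : i < (2 * n).+1)%N)) //= coefZ coefXn eqxx mulr1.
  rewrite big1 ?addr0 => [/eqP|j neq_j].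
    by rewrite mulrn_eq0 -leqn0 leqNgt bin_gt0 le_i => /eqP.
  rewrite coefZ coefXn; case: eqP => [e|]; last by rewrite mulr0.
  by case/eqP: neq_j; apply: val_inj => /=; have := ltn_ord j; lia.
apply: (mcls_descent_linforms uv (forms_linformX v n.+1) (r := n.-1)); first by lia.
move=> j le_j; rewrite -mulrA -exprD; apply: (omega_form_eq0 om n_gt0).
  rewrite (_ : 2 * n = j + (n.-1 - j + n.+1))%N; last by lia.
  by apply: forms_mul; apply: forms_linformX.
have le_i : (n.-1 - j + n.+1 <= 2 * n)%N by lia.
have := c0 (n.-1 - j + n.+1)%N; rewrite le_i andbT => <-; last by lia.
by congr (omega (cls (_ ^+ _ * _))); lia.
Qed.

(** Up to the bracket, [linform (perp v)] is the coordinate [s] along [u], and differentiating [Q]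
    along [u] leaves [n.+2%:R * s ^+ n.+1]. *)
Lemma cls_perp u v : bracket u v != 0 ->
    (forall s t, value Q (s *: u + t *: v) = s ^+ n.+2 + t ^+ n.+2) ->
  cls (linform (perp v) ^+ n.+1) = 0.
Proof.
move=> uv QE; pose k := n.+2%:R / bracket u v ^+ n.+1.
have k0 : k != 0 by rewrite mulf_neq0 ?pnatr_eq0 // invr_eq0 expf_neq0.
have dQ : u 0 0 *: Q_ 0 + u 0 1 *: Q_ 1 = k *: linform (perp v) ^+ n.+1.
  apply: (form_value_inj (d := n.+1)).
  - by apply: forms_add; apply: forms_scale; apply: forms_partial.
  - by apply: forms_scale; apply: forms_linformX.
  move=> z; pose s := bracket z v / bracket u v; pose t := bracket u z / bracket u v.
  have lineE : on_line u (t *: v) Q = 'X^(n.+2) + (t ^+ n.+2)%:P.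
    by apply: horner_inj => x; rewrite value_on_line QE hornerD hornerXn hornerC.
  have := deriv_on_line_value u (t *: v) Q s.
  rewrite -(row2_coords z uv) lineE derivD derivXn derivC addr0 hornerMn hornerXn /= => e.
  rewrite {1}/value mevalD !mevalZ -!/(value _ z) -e.
  rewrite {1}/value mevalZ -/(value _ z) valueX value_linform_dot dot_perp.
  by rewrite /s expr_div_n /k -mulr_natr mulrC mulrA [RHS]mulrAC.
apply/mcls_eq0; exists (k^-1 * u 0 0)%:MP, (k^-1 * u 0 1)%:MP.
by rewrite !mul_mpolyC -!scalerA -scalerDr dQ scalerA mulVf // scale1r.
Qed.

(** By [cls_perp], only the middle term of the binomial expansion in the dual basis survives. *)
Lemma associated_form_Fermat u v (BQ : {mpoly C[2]}) : bracket u v != 0 ->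
    (forall s t, value Q (s *: u + t *: v) = s ^+ n.+2 + t ^+ n.+2) ->
    (forall z, value BQ z = omega (cls (linform z ^+ (2 * n)))) ->
  exists2 k : C, k != 0 & forall z, value BQ z = k * (dot z u ^+ n * dot z v ^+ n).
Proof.
move=> uv QE BQE; pose U := linform (perp v); pose V := linform (perp u).
have U0 : cls (U ^+ n.+1) = 0 by apply: (cls_perp uv).
have V0 : cls (V ^+ n.+1) = 0.
  apply: (@cls_perp v u) => [|s t]; first by rewrite bracketC oppr_eq0.
  by rewrite addrC QE addrC.
have mixed0 i : (i <= 2 * n)%N -> i != n -> cls (U ^+ (2 * n - i) * V ^+ i) = 0.
  move=> le_i neq_i; have [lt_in|lt_ni|e] := ltngtP i n;
    last by rewrite e eqxx in neq_i.
    have -> : (2 * n - i = n.+1 + (n.-1 - i))%N by lia.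
    by rewrite exprD !mclsM U0 !mul0r.
  have -> : i = (n.+1 + (i - n.+1))%N by lia.
  by rewrite exprD !mclsM V0 mul0r mulr0.
(* Otherwise all products of degree [2 * n] would be zero, and duality would make [1] zero. *)
have mid : cls (U ^+ n * V ^+ n) <> 0.
  move=> mid0; have pv : bracket (perp v) (perp u) != 0 by rewrite bracket_perp bracketC oppr_eq0.
  have := @mcls_descent_linforms _ _ hm Q _ _ 0%N (2 * n)%N 1 pv (dhomog1 _ _).
  rewrite mcls1 => one0; suff /eqP : (1 : milnor hm Q) = 0 by rewrite oner_eq0.
  apply: one0 => [//|j le_j]; rewrite mulr1.
  have [->|neq_j] := eqVneq j n; first by rewrite (_ : 2 * n - n = n)%N //; lia.
  have := @mixed0 (2 * n - j)%N; rewrite subKn // => -> //; first by lia.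
  by apply: contraNneq neq_j => e; apply/eqP; lia.
have mid_form : forms (2 * n) (U ^+ n * V ^+ n).
  by rewrite mul2n -addnn; apply: forms_mul; apply: forms_linformX.
(* The last two powers come from the normalization of the dual basis. *)
exists (('C(2 * n, n)%:R * omega (cls (U ^+ n * V ^+ n))) *
   ((bracket u v)^-1 ^+ n * (- (bracket u v)^-1) ^+ n)).
  have b0 : (bracket u v)^-1 != 0 by rewrite invr_eq0.
  rewrite !mulf_neq0 ?expf_neq0 ?oppr_eq0 //.
    by rewrite pnatr_eq0 -lt0n bin_gt0; lia.
  by apply/eqP => /(omega_form_eq0 om n_gt0 mid_form).
move=> z; rewrite BQE (linform_coords z uv) -scaleNr omega_binomial.
have lt_n : (n < (2 * n).+1)%N by lia.
rewrite (bigD1 (Ordinal lt_n)) //= big1 ?addr0 => [|i neq_i].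
  rewrite (_ : 2 * n - n = n)%N; last by lia.
  rewrite -/U -/V -mulr_natl -mulrN !exprMn.
  move: (omega _) => w; ring.
rewrite (mixed0 i) ?omega0 ?mulr0 // -1?ltnS //.
Qed.

End AssociatedForm.

(* That is, v is a root of f of multiplicity at least n. *)
Lemma nonstable_root (R : realType) (n : nat) (f : {mpoly R[i][2]}) : (0 < n)%N ->
    forms (2 * n) f -> ~ stable (2 * n) f ->
  exists u v, bracket u v != 0 /\ exists g, on_line u v f = 'X^n * g.
Proof.
move=> n_gt0 hf; have [c [w [w0 ->]]] := form_factor hf => nst.
have [c0|c0] := eqVneq c 0.
  exists (delta_mx 0 0), (delta_mx 0 1); split.
    by rewrite /bracket !mxE /= mulr1 mulr0 subr0 oner_eq0.
  by exists 0; rewrite c0 scale0r mulr0 rmorph0.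
have [|r rc] := @root_exists R (2 * n) c; first by rewrite muln_gt0.
have r0 : r != 0 by apply: contraNneq c0 => r0;
  rewrite -rc r0 expr0n eqn0Ngt muln_gt0 n_gt0.
pose l k := r *: w k; have l0 k : l k != 0 by rewrite scaler_eq0 negb_or r0 w0.
have fE : c *: prodform w = prodform l.
  by rewrite prodformZ prodr_const card_ord rc.
rewrite fE in nst *.
(* Were every class smaller than [n], the form would be stable. *)
have [e ge_e] : exists e, (n <= #|[pred k | proj_point (l k) == e]|)%N.
  apply: contrapT => no_e; apply: nst; apply: (stable_prodform (card_ord _) l0) => e.
  by rewrite ltnNge; apply/negP => ge_e; apply: no_e; exists e.
have /card_gt0P[k0 k0e] := leq_trans n_gt0 ge_e.
have [u lu] := exists_dot_neq0 (l0 k0).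
exists u, (perp (l k0)); split.
  by rewrite bracket_perpr oppr_eq0.
suff /dvdpP[g ->] : 'X^n %| on_line u (perp (l k0)) (prodform l) by exists g;
  rewrite mulrC.
rewrite rmorph_prod /= (bigID [pred k | proj_point (l k) == e]) /=.
apply/dvdp_mulr/(dvdp_trans (dvdp_exp2l 'X ge_e)); rewrite -prodr_const.
apply: (big_ind2 (fun p q : {poly R[i]} => p %| q)) => // [p q p' q' pq pq'|k ke].
  exact: dvdp_mul.
(* A factor in the class of [l k0] vanishes at [perp (l k0)], so its restriction has no constant
   term. *)
have -> : on_line u (perp (l k0)) (linform (l k)) = dot (l k) u *: 'X.
  rewrite on_line_linform (_ : dot _ (perp _) = 0) ?addr0 //.
  transitivity (bracket (l k) (l k0)); first by rewrite /dot /bracket !mxE /=; ring.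
  by apply/eqP; rewrite bracket_eq0 // (eqP ke) eq_sym.
by rewrite -mul_polyC dvdp_mull.
Qed.

Lemma value_XnD (R : realType) (k : nat) (z : 'rV[R[i]]_2) :
  value ('X_0 ^+ k + 'X_1 ^+ k) z = z 0 0 ^+ k + z 0 1 ^+ k.
Proof.
rewrite /value mevalD; congr (_ + _).
  by rewrite -[LHS]/(value _ z) valueX /value mevalXU.
by rewrite -[LHS]/(value _ z) valueX /value mevalXU.
Qed.

Lemma value_XnM (R : realType) (k : nat) (z : 'rV[R[i]]_2) :
  value ('X_0 ^+ k * 'X_1 ^+ k) z = z 0 0 ^+ k * z 0 1 ^+ k.
Proof.
rewrite /value mevalM; congr (_ * _).
  by rewrite -[LHS]/(value _ z) valueX /value mevalXU.
by rewrite -[LHS]/(value _ z) valueX /value mevalXU.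
Qed.

Theorem proposition5p3 (R : realType) (m : nat) (hm : (3 <= m)%N)
  (Q : X2 R m) (BQ : {mpoly R[i][2]}) :
  is_associated_form hm Q BQ ->
  ~ stable (2 * (m - 2)) BQ ->
  lin_equiv Q ('X_0 ^+ m + 'X_1 ^+ m) /\
  lin_equiv BQ ('X_0 ^+ (m - 2) * 'X_1 ^+ (m - 2)).
Proof.
case: m hm Q => [|[|n]] // hm Q; rewrite /is_associated_form !subSS !subn0.
have n_gt0 : (0 < n)%N by [].
case=> hBQ [omega om BQE] nst.
have {}BQE z : value BQ z = omega (mcls hm Q (linform z ^+ (2 * n))).
  by rewrite BQE e_linform /mcls rmorphXn.
have [a [b [ab [g BQg]]]] := nonstable_root n_gt0 hBQ nst.
have b0 : b != 0.
  by apply: contraNneq ab => ->; rewrite /bracket !mxE !mulr0 subrr.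
have [c [d [x [y [cd x0 y0 QE]]]]] :=
  Fermat_coordinates n_gt0 b0 (power_in_ideal n_gt0 om ab BQE BQg).
(* Rescaling the two directions turns both coefficients into one. *)
have [|r rx] := @root_exists R n.+2 x^-1; first by [].
have [|t ty] := @root_exists R n.+2 y^-1; first by [].
have r0 : r != 0 by apply: contraNneq (invr_neq0 x0) => r0; rewrite -rx r0 expr0n.
have t0 : t != 0 by apply: contraNneq (invr_neq0 y0) => t0; rewrite -ty t0 expr0n.
pose u := r *: c; pose v := t *: d.
have uv : bracket u v != 0.
  rewrite bracketZl mulf_neq0 // bracketC oppr_eq0 bracketZl mulf_neq0 //.
  by rewrite bracketC oppr_eq0.
have QF s s' : value Q (s *: u + s' *: v) = s ^+ n.+2 + s' ^+ n.+2.
  by rewrite !scalerA QE !exprMn rx ty; congr (_ + _); rewrite mulrC divfK.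
split.
  apply: (lin_equiv_value (X2_homog Q) _ (rows2_unit uv)) => [|z].
    have hX j : forms n.+2 ('X_j ^+ n.+2 : {mpoly R[i][2]}).
      by rewrite -[X in forms X]mul1n; apply: dhomogMn; rewrite dhomogX /= mdeg1.
    exact: forms_add.
  by rewrite value_XnD mul_rows2 -QF.
have [k k0 BQF] := associated_form_Fermat n_gt0 om uv QF BQE.
have [|q qk] := @root_exists R (2 * n) k^-1; first by rewrite muln_gt0.
have q0 : q != 0.
  by apply: contraNneq (invr_neq0 k0) => q0;
    rewrite -qk q0 expr0n eqn0Ngt muln_gt0 n_gt0.
have uN : (rows2 u v)^T \in unitmx by rewrite unitmx_tr rows2_unit.
(* This matrix turns the pairings with [u] and [v] into [q] times the coordinates; the [2 * n]
   factors [q] then cancel [k]. *)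
apply: (lin_equiv_value (M := q *: invmx (rows2 u v)^T) hBQ).
- by rewrite mul2n -addnn; apply: forms_xpow.
- by rewrite unitmxZ ?unitfE // unitmx_inv.
move=> z; rewrite BQF.
have := dot_rows2 u v (z *m (q *: invmx (rows2 u v)^T)).
rewrite -scalemxAr -scalemxAl mulmxKV // => /rowP zE.
have := zE 0; have := zE 1; rewrite !mxE /= => <- <-.
by rewrite value_XnM !exprMn (mulrACA (q ^+ n)) -exprD addnn -mul2n qk mulVKf.
Qed.
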